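(* There exist universal constants $C,c>0$ such that the following holds. Let $1\le m\le n\le N$ be integers, let $1\le r\le 2$, $\psi\ge 1$ and $\lambda\in(0,1/2)$. Let $X_1,\dots,X_N\in\mathbb{R}^n$ be independent centered random vectors such that $$ \|\langle X_i,y\rangle\|_{\psi_r}\le\psi\quad\text{for all } y\in S^{n-1}\text{ and } 1\le i\le N, $$ and $$ \mathbb{P}\left(\max_{i\le N}\left|\frac{|X_i|^2}{n}-1\right|\ge\frac{\sqrt2-1}{2}\right)<\lambda. $$ Let $A$ be the $n\times N$ matrix with $X_1,\dots,X_N$ as columns. Then, with probability larger than $$ 1-2\lambda-C\exp(-c\sqrt n/\psi^2), $$ the polytopes $K^+(A)$ and $K(A)$ are $m$-neighborly and $m$-centrally-neighborly, respectively, whenever $$ m\le \frac{cn}{\psi^4\log^{2/r}(C\psi^6N/n)}. $$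
   Context: $|\cdot|$ is the Euclidean norm, $S^{n-1}$ the Euclidean unit sphere of $\mathbb{R}^n$. For a real random variable $Y$ and $r>0$, $\|Y\|_{\psi_r}=\inf\{C>0:\ \mathbb{E}\exp((|Y|/C)^r)\le 2\}$. For an $n\times N$ matrix $A$ with columns $X_1,\dots,X_N$, $K^+(A)$ is the convex hull of $X_1,\dots,X_N$ and $K(A)$ is the convex hull of $\pm X_1,\dots,\pm X_N$. A polytope is $m$-neighborly if any set of less than $m$ of its vertices is the vertex set of a face. A centrally symmetric convex polytope is $m$-centrally-neighborly if any set of less than $m$ of its vertices containing no opposite pair (no $v$ together with $-v$) is the vertex set of a face. *)

(* Defs.v *)
From HB Require Import structures.
From mathcomp Require Import all_boot all_order all_algebra finmap.
From mathcomp Require Import all_classical all_reals all_analysis.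
Set Implicit Arguments.
Unset Strict Implicit.
Unset Printing Implicit Defensive.
Import Order.TTheory GRing.Theory Num.Theory.
Local Open Scope classical_set_scope.
Local Open Scope ring_scope.

Section euclidean.
Context {R : realType} {n : nat}.

Definition dotp (x y : 'cV[R]_n) : R := \sum_(i < n) x i 0 * y i 0.

(* The library norm on matrices is the sup norm, hence this definition. *)
Definition enorm (x : 'cV[R]_n) : R := Num.sqrt (dotp x x).

Definition usphere : set 'cV[R]_n := [set y | enorm y = 1].

End euclidean.

Section polytopes.
Context {R : realType} {n : nat}.
Implicit Types (K F : set 'cV[R]_n).

Definition conv_hull (S : set 'cV[R]_n) : set 'cV[R]_n :=
  smallest (@convex_set R 'cV[R]_n) S.

Definition Kplus {N : nat} (A : 'M[R]_(n, N)) : set 'cV[R]_n :=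
  conv_hull (range (fun j : 'I_N => col j A)).

Definition Ksym {N : nat} (A : 'M[R]_(n, N)) : set 'cV[R]_n :=
  conv_hull (range (fun j : 'I_N => col j A) `|`
             range (fun j : 'I_N => - col j A)).

(* A face is cut out by equality in a linear inequality valid on K. Taking
   a = 0 shows that the improper faces set0 and K are included. *)
Definition is_face K F : Prop :=
  exists (a : 'cV[R]_n) (b : R),
    (forall x, K x -> dotp a x <= b) /\ F = K `&` [set x | dotp a x = b].

Definition vertices K : set 'cV[R]_n := [set v | is_face K [set v]].

Definition neighborly (m : nat) K : Prop :=
  forall V : {fset 'cV[R]_n},
    (#|` V| < m)%N -> [set` V] `<=` vertices K ->
    exists2 F, is_face K F & vertices F = [set` V].

Definition centrally_neighborly (m : nat) K : Prop :=
  forall V : {fset 'cV[R]_n},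
    (#|` V| < m)%N -> [set` V] `<=` vertices K ->
    (forall v, ~ (v \in V /\ - v \in V)) ->
    exists2 F, is_face K F & vertices F = [set` V].

End polytopes.

Section probability.
Context {d : measure_display} {T : measurableType d} {R : realType}.
Variable P : probability T R.

(* The infimum is +oo when no C is admissible. *)
Definition psi_norm (r : R) (Y : T -> R) : \bar R :=
  ereal_inf [set C%:E | C in
    [set C : R | 0 < C /\
      ('E_P[fun w => expR ((`|Y w| / C) `^ r)] <= 2%:E)%E]].

Definition independent_RVs {d' : measure_display} {T' : measurableType d'}
    {I : finType} (X : I -> {RV P >-> T'}) : Prop :=
  forall (J : {set I}) (B : I -> set T'),
    (forall i, measurable (B i)) ->
    P [set w | forall i, i \in J -> B i (X i w)] =
    (\prod_(i in J) P (X i @^-1` B i))%E.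

(* Random vectors of R^n take values in n.-tuple R, which the library equips
   with the product (that is, Borel) sigma-algebra. *)
Definition vec {n : nat} (x : n.-tuple R) : 'cV[R]_n := \col_i tnth x i.

Definition centered {n : nat} (X : {RV P >-> n.-tuple R}) : Prop :=
  forall i : 'I_n,
    P.-integrable [set: T] (fun w => (tnth (X w) i)%:E) /\
    ('E_P[fun w => tnth (X w) i] = 0)%E.

Definition colmx {n N : nat} (X : 'I_N -> {RV P >-> n.-tuple R}) (w : T) :
    'M[R]_(n, N) := \matrix_(i, j) vec (X j w) i 0.

End probability.

(* Main.v *)
Require Import Defs.
From HB Require Import structures.
From mathcomp Require Import all_boot all_order all_algebra finmap.
From mathcomp Require Import all_classical all_reals all_analysis.
From mathcomp Require Import measurable_realfun ring lra.
Set Implicit Arguments.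
Unset Strict Implicit.
Unset Printing Implicit Defensive.
Import Order.TTheory GRing.Theory Num.Theory.
Local Open Scope classical_set_scope.
Local Open Scope ring_scope.

(** Write off(z) for the sum of z_i z_j <X_i, X_j> over i <> j. If
    |X_i|^2 is within n/4 of n and off(z) >= - n |z|^2 / 4 for all 4^L-sparse z,
    then |Az|^2 >= n |z|^2 / 2 for these z. By Maurey's sampling argument the
    kernel of A then satisfies a null space property, and Hahn-Banach produces y
    with <y, X_i> = +1 or -1, as prescribed, on the chosen vertices and
    |<y, X_j>| < 1 for the other columns: y exposes the required face.

    As off is affine in each coordinate, it only has to be bounded at the vectors
    x with coordinates 0 or +-2^-l, l <= L. Ordering the coordinates by level l
    and then by index, off(x) is twice the sum of x_j <X_j, w_j>, where w_j is the
    sum of the x_i X_i with i before j. Conditioning on all columns but the last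
    one, repeatedly, the sum of (|<X_j, w_j>| / (2 psi |w_j|))^r over a level has
    exponential moment at most 2 to the size of that level. A union bound over
    the finitely many x tames all these sums at once, and adding up the levels
    gives |off(x)| <= C psi Lam^(1/r) 2^L S with S = max |Ax|, where Lam is the
    logarithm in the theorem. Since S^2 <= 25/4 n + max |off|, this bounds S and
    then off, provided 2^L Lam^(1/r) is a small multiple of sqrt(n) / psi^2;
    L is chosen largest with this property. *)

(** * Inner product and Euclidean norm *)

Section dotp_theory.
Context {R : realType} {n : nat}.
Implicit Types x y z : 'cV[R]_n.

Lemma dotpC x y : dotp x y = dotp y x.
Proof. by apply: eq_bigr => i _; rewrite mulrC. Qed.

Lemma dotpDr x y z : dotp x (y + z) = dotp x y + dotp x z.
Proof. by rewrite -big_split; apply: eq_bigr => i _; rewrite mxE mulrDr. Qed.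

Lemma dotpZr a x y : dotp x (a *: y) = a * dotp x y.
Proof. by rewrite mulr_sumr; apply: eq_bigr => i _; rewrite mxE mulrCA. Qed.

Lemma dotp0r x : dotp x 0 = 0.
Proof. by apply: big1 => i _; rewrite mxE mulr0. Qed.

Lemma dotpNr x y : dotp x (- y) = - dotp x y.
Proof. by rewrite -scaleN1r dotpZr mulN1r. Qed.

Lemma dotpDl x y z : dotp (y + z) x = dotp y x + dotp z x.
Proof. by rewrite dotpC dotpDr !(dotpC x). Qed.

Lemma dotpZl a x y : dotp (a *: y) x = a * dotp y x.
Proof. by rewrite dotpC dotpZr dotpC. Qed.

Lemma dotp0l x : dotp 0 x = 0.
Proof. by rewrite dotpC dotp0r. Qed.

Lemma dotp_sumr (I : Type) (s : seq I) (Q : pred I) (F : I -> 'cV[R]_n) x :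
  dotp x (\sum_(i <- s | Q i) F i) = \sum_(i <- s | Q i) dotp x (F i).
Proof.
apply: (big_morph (dotp x)); last exact: dotp0r.
by move=> ? ?; rewrite dotpDr.
Qed.

Lemma dotp_suml (I : Type) (s : seq I) (Q : pred I) (F : I -> 'cV[R]_n) x :
  dotp (\sum_(i <- s | Q i) F i) x = \sum_(i <- s | Q i) dotp (F i) x.
Proof. by rewrite dotpC dotp_sumr; apply: eq_bigr => i _; rewrite dotpC. Qed.

Lemma dotpp_ge0 x : 0 <= dotp x x.
Proof. by apply: sumr_ge0 => i _; rewrite -expr2 sqr_ge0. Qed.

Lemma enorm_ge0 x : 0 <= enorm x.
Proof. exact: sqrtr_ge0. Qed.

Lemma sqr_enorm x : enorm x ^+ 2 = dotp x x.
Proof. by rewrite sqr_sqrtr // dotpp_ge0. Qed.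

Lemma enorm0_eq0 x : enorm x = 0 -> x = 0.
Proof.
move=> x0; have : dotp x x = 0 by rewrite -sqr_enorm x0 expr0n.
move/psumr_eq0P => H; apply/colP => i; rewrite mxE.
apply/eqP; rewrite -sqrf_eq0 expr2; apply/eqP; apply: H => // j _.
by rewrite -expr2 sqr_ge0.
Qed.

End dotp_theory.

(** * Faces and vertices of the convex hull of a finite family *)

Section polytope_faces.
Context {R : realType} {n : nat} {J : finType} (p : J -> 'cV[R]_n).

Lemma conv_hull_gen j : conv_hull (range p) (p j).
Proof. by apply: sub_gen_smallest; exists j. Qed.

(** The convex combinations form a convex set [D] that contains the generators, so [D] contains the
    smallest such set. *)
Lemma conv_hull_comb x : conv_hull (range p) x ->
  exists l : J -> R,
    [/\ forall j, 0 <= l j, \sum_j l j = 1 & x = \sum_j l j *: p j].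
Proof.
pose D : set 'cV[R]_n := [set x | exists l : J -> R,
    [/\ forall j, 0 <= l j, \sum_j l j = 1 & x = \sum_j l j *: p j]].
suff : conv_hull (range p) `<=` D by apply.
apply: smallest_sub.
  move=> y z t /set_mem [l [l0 l1 ->]] /set_mem [k [k0 k1 ->]].
  apply/mem_set => /=.
  exists (fun j => t%:num * l j + (1 - t%:num) * k j); split.
  - move=> j; rewrite addr_ge0 // mulr_ge0 // ?ge0 // subr_ge0 le1.
  - by rewrite big_split -!mulr_sumr l1 k1 /= !mulr1; ring.
  - rewrite /conv /= /unstable.onem !scaler_sumr -big_split /=.
    apply: eq_bigr => j _.
    by rewrite [RHS]scalerDl !scalerA.
move=> _ [j _ <-]; exists (fun i => (i == j)%:R); split => //.
- by rewrite (bigD1 j) //= eqxx big1 ?addr0 // => i /negbTE ->.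
- rewrite (bigD1 j) //= eqxx scale1r big1 ?addr0 // => i /negbTE ->.
  by rewrite scale0r.
Qed.

Lemma is_face_sub (K F : set 'cV[R]_n) : is_face K F -> F `<=` K.
Proof. by move=> [a [b [_ ->]]] x []. Qed.

(** Complementary slackness: the terms [l j * (b - dotp a (p j))] are nonnegative with sum at most
    0, so each of them vanishes. *)
Lemma comb_max (a : 'cV[R]_n) (b : R) (l : J -> R) :
  (forall j, 0 <= l j) -> \sum_j l j = 1 ->
  (forall j, 0 < l j -> dotp a (p j) <= b) ->
  b <= dotp a (\sum_j l j *: p j) -> forall j, 0 < l j -> dotp a (p j) = b.
Proof.
move=> l0 l1 ab; rewrite dotp_sumr => hb j lj.
have E : \sum_j l j * (b - dotp a (p j)) = 0.
  apply/eqP; rewrite eq_le; apply/andP; split; last first.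
    apply: sumr_ge0 => i _; have := l0 i; rewrite le_eqVlt => /orP[/eqP <-|li].
      by rewrite mul0r.
    by rewrite mulr_ge0 // subr_ge0 ab.
  under eq_bigr do rewrite mulrBr.
  rewrite sumrB -mulr_suml l1 mul1r subr_le0 (le_trans hb) //.
  by apply: ler_sum => i _; rewrite dotpZr.
have : l j * (b - dotp a (p j)) = 0.
  move/psumr_eq0P: E => -> // i _.
  have := l0 i; rewrite le_eqVlt => /orP[/eqP <-|li]; first by rewrite mul0r.
  by rewrite mulr_ge0 // subr_ge0 ab.
by move/eqP; rewrite mulf_eq0 gt_eqF //= subr_eq0 => /eqP.
Qed.

Lemma weight_gt0 (l : J -> R) :
  (forall j, 0 <= l j) -> \sum_j l j = 1 -> exists j, 0 < l j.
Proof.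
move=> l0 l1; apply/not_existsP => H.
move: l1; rewrite big1 => [/esym/eqP|j _]; first by rewrite oner_eq0.
by apply/eqP; rewrite eq_le l0 andbT leNgt; apply/negP/H.
Qed.

(** Settles the case of no prescribed vertices: the inequality [0 <= 1], never tight, cuts out the
    empty face. *)
Lemma empty_face (K : set 'cV[R]_n) :
  exists2 F, is_face K F & vertices F = set0.
Proof.
exists set0.
  exists 0, 1; split => [x _|]; first by rewrite dotp0l.
  by apply/seteqP; split => // x [_ /=] /eqP; rewrite dotp0l eq_sym oner_eq0.
by apply/seteqP; split => // v /is_face_sub; exact.
Qed.

(** A functional exposing [v] is maximal at each generator of positive weight in a representation of
    [v]; such a generator must be [v] itself. *)
Lemma vertex_gen v : vertices (conv_hull (range p)) v -> exists j, v = p j.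
Proof.
move=> [a [b [ab vE]]].
have [/= Kv av] : (conv_hull (range p) `&` [set x | dotp a x = b]) v by rewrite -vE.
have [l [l0 l1 vl]] := conv_hull_comb Kv.
have [j lj] := weight_gt0 l0 l1.
exists j; suff : [set v] (p j) by [].
rewrite vE; split; first exact: conv_hull_gen.
apply: (comb_max l0 l1) lj => [i _|]; last by rewrite -vl av.
by apply: ab; exact: conv_hull_gen.
Qed.

Lemma face_of_certificate (V : {fset 'cV[R]_n}) (y : 'cV[R]_n) :
  [set` V] `<=` vertices (conv_hull (range p)) ->
  (forall v, v \in V -> dotp y v = 1) ->
  (forall j, p j \notin V -> dotp y (p j) < 1) ->
  exists2 F, is_face (conv_hull (range p)) F & vertices F = [set` V].
Proof.
set K := conv_hull (range p) => VK yV yN.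
have yle j : dotp y (p j) <= 1.
  by case: (boolP (p j \in V)) => [/yV ->//|/yN/ltW].
exists (K `&` [set x | dotp y x = 1]).
  exists y, 1; split => // x /conv_hull_comb [l [l0 l1 ->]].
  rewrite dotp_sumr -[leRHS]l1; apply: ler_sum => j _.
  by rewrite dotpZr -[leRHS]mulr1 ler_wpM2l.
apply/seteqP; split => [v|v vV].
(* Only generators in [V] carry weight in a point of the face, and one that carries weight in a
   vertex equals this vertex. *)
- move=> [a [b [ab vE]]].
  have [[/= Kv yv] av] :
    (K `&` [set x | dotp y x = 1] `&` [set x | dotp a x = b]) v by rewrite -vE.
  have [l [l0 l1 vl]] := conv_hull_comb Kv.
  have yl : forall j, 0 < l j -> dotp y (p j) = 1.
    by apply: comb_max => //; rewrite -vl yv.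
  have lV j : 0 < l j -> p j \in V.
    by move=> /yl yj; apply: contraT => /yN; rewrite yj ltxx.
  have [j lj] := weight_gt0 l0 l1.
  suff /= <- : [set v] (p j) by apply: lV.
  rewrite vE; split; first by split; [exact: conv_hull_gen|exact: yl].
  apply: (comb_max l0 l1) lj => [i li|]; last by rewrite -vl av.
  by apply: ab; split; [exact: conv_hull_gen|exact: yl].
(* A functional that exposes [v] in the whole hull also exposes it in the face. *)
- have [a [b [ab vE]]] := VK v vV.
  have [Kv av] : (K `&` [set x | dotp a x = b]) v by rewrite -vE.
  exists a, b; split => [x [/ab]//|].
  apply/seteqP; split => [_ ->|x [[Kx _] ax]].
    by split => //; split => //; exact: yV.
  by rewrite vE; split.
Qed.

End polytope_faces.

(** * Hahn-Banach separation on the kernel of a matrix *)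

Section sublinear_separation.
Context {R : realType}.

(* The extension step of Hahn-Banach: [g] separates the lower bounds in [Lo] from
   the values that the sublinear form takes on the opposite side. *)
Lemma sublinear_step (n N : nat) (X : 'I_N -> 'cV[R]_n) (p : 'I_N -> R -> R)
    (i : 'I_N) :
  (forall i s t, p i (s + t) <= p i s + p i t) ->
  (forall i a t, 0 <= a -> p i (a * t) = a * p i t) ->
  (forall h : 'I_N -> R, \sum_j h j *: X j = 0 -> 0 <= \sum_j p j (h j)) ->
  exists g, (forall t, g * t <= p i t) /\
    (forall h : 'I_N -> R, \sum_j h j *: X j = 0 ->
       0 <= g * h i + \sum_(j | j != i) p j (h j)).
Proof.
move=> padd pmul pge0.
pose rest (h : 'I_N -> R) := \sum_(j | j != i) p j (h j).
have p0 j : p j 0 = 0 by have := pmul j 0 0 (lexx _); rewrite !mul0r.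
pose Lo := [set t | t = - p i (-1) \/
  exists h, [/\ \sum_j h j *: X j = 0, h i = 1 & t = - rest h]].
(* Lower bounds lie below upper bounds. In the fourth case [h + k] is a kernel vector vanishing at
   [i], so only the other coordinates contribute. *)
have bnd t u : Lo t -> (u = p i 1 \/
  exists h, [/\ \sum_j h j *: X j = 0, h i = -1 & u = rest h]) -> t <= u.
  move=> [->|[h [hX hi ->]]] [->|[k [kX ki ->]]].
  - by have := padd i 1 (-1); rewrite subrr p0; lra.
  - by have := pge0 k kX; rewrite (bigD1 i) //= ki -/(rest k); lra.
  - by have := pge0 h hX; rewrite (bigD1 i) //= hi -/(rest h); lra.
  - have hk0 : \sum_j (h j + k j) *: X j = 0.
      under eq_bigr do rewrite scalerDl.
      by rewrite big_split /= hX kX addr0.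
    have := pge0 _ hk0; rewrite (bigD1 i) //= hi ki subrr p0 add0r => H.
    have : \sum_(j | j != i) p j (h j + k j) <= rest h + rest k.
      by rewrite /rest -big_split; apply: ler_sum => j _; exact: padd.
    lra.
have supLo : has_sup Lo.
  split; first by exists (- p i (-1)); left.
  by exists (p i 1) => t Lt; apply: bnd => //; left.
pose g := sup Lo.
have gub t : Lo t -> t <= g by move=> Lt; apply: (sup_upper_bound supLo).
have glb u : (u = p i 1 \/
  exists h, [/\ \sum_j h j *: X j = 0, h i = -1 & u = rest h]) -> g <= u.
  by move=> Hu; apply: ge_sup; [case: supLo|move=> t Lt; exact: bnd].
have scal (h : 'I_N -> R) a : \sum_j h j *: X j = 0 -> \sum_j (a * h j) *: X j = 0.
  move=> hX; under eq_bigr do rewrite -scalerA.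
  by rewrite -scaler_sumr hX scaler0.
have restZ h a : 0 <= a -> rest (fun j => a * h j) = a * rest h.
  by move=> a0; rewrite /rest mulr_sumr; apply: eq_bigr => j _; rewrite pmul.
exists g; split => [t|h hX].
- have [t0|t0|->] := ltgtP t 0; last by rewrite mulr0 p0.
  + have := gub (- p i (-1)) (or_introl erefl).
    have t0' : 0 <= - t by rewrite oppr_ge0 ltW.
    have := pmul i (- t) (-1) t0'; rewrite mulrN1 opprK => ->.
    by move=> H; rewrite mulNr -mulrN [leRHS]mulrC ler_nM2r.
  + have := glb (p i 1) (or_introl erefl).
    have := pmul i t 1 (ltW t0); rewrite mulr1 => -> gp.
    by rewrite mulrC ler_pM2l.
(* By homogeneity [h i] may be taken as -1, 1 or 0; the first two cases are the bounds between which
   [g] was chosen. *)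
- have [t0|t0|t0] := ltgtP (h i) 0.
  + have ti : (- h i)^-1 * h i = -1 by rewrite invrN mulNr mulVf // lt_eqF.
    have := glb (rest (fun j => (- h i)^-1 * h j)).
    have i0 : 0 <= (- h i)^-1 by rewrite invr_ge0 oppr_ge0 ltW.
    rewrite restZ // => H.
    have {H} : g <= (- h i)^-1 * rest h.
      apply: H; right; exists (fun j => (- h i)^-1 * h j); split => //.
        exact: scal.
      by rewrite restZ.
    by rewrite ler_pdivlMl ?oppr_gt0 // -/(rest h); lra.
  + have ti : (h i)^-1 * h i = 1 by rewrite mulVf // gt_eqF.
    have := gub (- rest (fun j => (h i)^-1 * h j)).
    have i0 : 0 <= (h i)^-1 by rewrite invr_ge0 ltW.
    rewrite restZ // => H.
    have {H} : - ((h i)^-1 * rest h) <= g.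
      apply: H; right; exists (fun j => (h i)^-1 * h j); split => //.
        exact: scal.
      by rewrite restZ.
    by rewrite -mulrN ler_pdivrMl // -/(rest h); lra.
  + by have := pge0 h hX; rewrite (bigD1 i) //= t0 p0 mulr0.
Qed.

(** The sublinear forms are replaced one after the other by linear ones below them, keeping the sum
    nonnegative on the kernel. Once all are linear, the inequality at [- h] turns nonnegativity into
    equality. *)
Lemma sublinear_separation (n N : nat) (X : 'I_N -> 'cV[R]_n)
    (p : 'I_N -> R -> R) :
  (forall i s t, p i (s + t) <= p i s + p i t) ->
  (forall i a t, 0 <= a -> p i (a * t) = a * p i t) ->
  (forall h : 'I_N -> R, \sum_j h j *: X j = 0 -> 0 <= \sum_j p j (h j)) ->
  exists g : 'I_N -> R, (forall i t, g i * t <= p i t) /\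
    (forall h : 'I_N -> R, \sum_j h j *: X j = 0 -> \sum_j g j * h j = 0).
Proof.
move=> padd pmul pge0.
suff [g [gp gX]] : exists g : 'I_N -> R, (forall i t, g i * t <= p i t) /\
    (forall h : 'I_N -> R, \sum_j h j *: X j = 0 -> 0 <= \sum_j g j * h j).
  exists g; split => // h hX; apply/eqP; rewrite eq_le gX // andbT.
  have hN : \sum_j (- h j) *: X j = 0.
    by under eq_bigr do rewrite scaleNr; rewrite sumrN hX oppr0.
  by have := gX _ hN; under eq_bigr do rewrite mulrN; rewrite sumrN oppr_ge0.
suff [q [q1 q2 q3 q4]] : exists q : 'I_N -> R -> R,
    [/\ (forall i s t, q i (s + t) <= q i s + q i t),
        (forall i a t, 0 <= a -> q i (a * t) = a * q i t),
        (forall h : 'I_N -> R, \sum_j h j *: X j = 0 -> 0 <= \sum_j q j (h j)) &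
        (forall i t, q i t <= p i t) /\
        (forall i, i \in enum 'I_N -> exists g, forall t, q i t = g * t)].
  case: q4 => qp /(_ _ (mem_enum _ _))/cid-/all_sig[g gE].
  exists g; split => [i t|h /q3]; first by rewrite -gE.
  by under eq_bigr do rewrite gE.
elim: (enum 'I_N) => [|i s [q [q1 q2 q3 [qp qg]]]]; first by exists p; split.
have [g [gi gX]] := sublinear_step i q1 q2 q3.
exists (fun j => if j == i then fun t => g * t else q j); split.
- by move=> j u v; case: eqP => // _; rewrite mulrDr.
- by move=> j a t a0; case: eqP => [_|_]; [rewrite mulrCA|rewrite q2].
- move=> h /gX H; rewrite (bigD1 i) //= eqxx.
  by rewrite (eq_bigr (fun j => q j (h j))) // => j /negbTE ->.
- split => j; first by move=> t; case: eqP => [->|_] //; exact: le_trans (qp _ _).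
  rewrite inE; case: eqP => [_ _|_ /= /qg //]; by exists g.
Qed.

(** The columns of [cokermx A] lie in the kernel of [A], so [g] annihilates them and belongs to the
    row space; [y] collects the coefficients. *)
Lemma row_space_certificate (n N : nat) (A : 'M[R]_(n, N)) (g : 'I_N -> R) :
  (forall h : 'I_N -> R, \sum_j h j *: col j A = 0 -> \sum_j g j * h j = 0) ->
  exists y : 'cV[R]_n, forall j, dotp y (col j A) = g j.
Proof.
move=> gA; pose G := \row_j g j.
have : (G <= A)%MS.
  have kerk k : \sum_j (cokermx A j k) *: col j A = 0.
    apply/colP => i; rewrite summxE [RHS]mxE.
    have := congr1 (fun M : 'M[R]_(n, N) => M i k) (mulmx_coker A).
    rewrite mxE [X in _ = X -> _]mxE => E; rewrite -[RHS]E.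
    apply: eq_bigr => j _; rewrite mxE [col j A i 0]mxE. by rewrite mulrC.
  rewrite submxE; apply/eqP/rowP => k; rewrite mxE [RHS]mxE -[RHS](gA _ (kerk k)).
  by apply: eq_bigr => j _; rewrite mxE.
move=> /submxP [D GE]; exists D^T => j.
have := congr1 (fun M : 'rV_N => M 0 j) GE; rewrite !mxE => ->.
by apply: eq_bigr => i _; rewrite !mxE.
Qed.

End sublinear_separation.

(** * Neighborliness from the null space property *)

Section null_space_property.
Context {R : realType}.

(** The property known from compressed sensing, with constant 1/2. A constant below 1 is what makes
    the certificate strictly smaller than 1 outside [S]. *)
Definition null_space_property (n N m : nat) (A : 'M[R]_(n, N)) :=
  forall (S : {set 'I_N}) (h : 'I_N -> R), (#|S| < m)%N ->
    \sum_j h j *: col j A = 0 ->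
    \sum_(j in S) `|h j| <= 2^-1 * \sum_(j | j \notin S) `|h j|.

(** Separation is applied to the form equal to e_j t on [S] and |t|/2 elsewhere; its sum is
    nonnegative on the kernel by the null space property. Comparing at t = 1 and t = -1 gives both
    conclusions. *)
Lemma dual_certificate (n N m : nat) (A : 'M[R]_(n, N)) (S : {set 'I_N})
    (e : 'I_N -> R) :
  null_space_property m A -> (#|S| < m)%N -> (forall j, `|e j| = 1) ->
  exists y, (forall j, j \in S -> dotp y (col j A) = e j) /\
            (forall j, j \notin S -> `|dotp y (col j A)| < 1).
Proof.
move=> nsp Sm e1.
pose p (j : 'I_N) (t : R) := if j \in S then e j * t else 2^-1 * `|t|.
have [g [gp gA]] : exists g : 'I_N -> R, (forall i t, g i * t <= p i t) /\
    (forall h : 'I_N -> R, \sum_j h j *: col j A = 0 -> \sum_j g j * h j = 0).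
  apply: sublinear_separation => [i s t|i a t a0|h hA].
  - rewrite /p; case: ifP => _; first by rewrite mulrDr.
    by rewrite -mulrDr ler_pM2l ?invr_gt0 // ler_normD.
  - by rewrite /p normrM (ger0_norm a0); case: ifP => _; rewrite mulrCA.
  - rewrite (bigID (mem S)) /=.
    rewrite [X in _ <= X + _](eq_bigr (fun j => e j * h j)); last first.
      by move=> j jS; rewrite /p jS.
    rewrite [X in _ <= _ + X](eq_bigr (fun j => 2^-1 * `|h j|)); last first.
      by move=> j /negbTE jS; rewrite /p jS.
    rewrite -mulr_sumr; have := nsp S h Sm hA.
    suff : - \sum_(j in S) `|h j| <= \sum_(j in S) e j * h j by lra.
    rewrite -sumrN; apply: ler_sum => j _.
    by rewrite lerNl (le_trans (ler_norm _)) // normrN normrM e1 mul1r.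
have [y yE] := row_space_certificate gA.
exists y; split => j jS; rewrite yE; have := gp j 1; have := gp j (-1).
  by rewrite /p jS; lra.
rewrite /p (negbTE jS) normrN normr1 => h1 h2.
by rewrite ltr_norml; apply/andP; split; lra.
Qed.

Lemma Kplus_neighborly (n N m : nat) (A : 'M[R]_(n, N)) :
  null_space_property m A -> neighborly m (Kplus A).
Proof.
move=> nsp V Vm VK.
have [->|/set0P [v0 v0V]] := eqVneq [set` V] set0; first exact: empty_face.
have gen v : v \in V -> exists j, v == col j A.
  by move=> /VK /vertex_gen [j ->]; exists j.
have [j0 _] := gen _ v0V.
(* Columns may coincide, so one index is chosen for each point of [V]; this keeps [S] no larger than
   [V]. *)
pose ix v := odflt j0 [pick j | v == col j A].
have ixE v : v \in V -> col (ix v) A = v.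
  move=> /gen [j vj]; rewrite /ix; case: pickP => [k /eqP //|/(_ j)].
  by rewrite vj.
pose S := [set j in map ix V].
have Sm : (#|S| < m)%N.
  by rewrite (leq_ltn_trans _ Vm) // cardsE (leq_trans (card_size _)) ?size_map.
have [y [yS yN]] := dual_certificate nsp Sm (fun _ => normr1 R).
apply: (face_of_certificate (y := y)) => // [v vV|j jV].
  rewrite -(ixE v vV); apply: yS; rewrite inE; exact: map_f.
have [jS|/yN] := boolP (j \in S); last by rewrite ltr_norml => /andP[].
move: jS; rewrite inE => /mapP [v vV jv].
by move: jV; rewrite jv ixE // vV.
Qed.

Lemma Ksym_neighborly (n N m : nat) (A : 'M[R]_(n, N)) :
  null_space_property m A -> centrally_neighborly m (Ksym A).
Proof.
move=> nsp V Vm VK Vopp.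
pose p (s : bool * 'I_N) := if s.1 then - col s.2 A else col s.2 A.
have KE : Ksym A = conv_hull (range p).
  congr conv_hull; apply/seteqP; split.
    by move=> _ [[j _ <-]|[j _ <-]]; [exists (false, j)|exists (true, j)].
  by move=> _ [[[] j] _ <-]; [right|left]; exists j.
rewrite KE in VK *.
have [->|/set0P [v0 v0V]] := eqVneq [set` V] set0; first exact: empty_face.
have gen v : v \in V -> exists j, (v == col j A) || (v == - col j A).
  by move=> /VK /vertex_gen [[b j] ->]; exists j; case: b; rewrite eqxx ?orbT.
have [j0 _] := gen _ v0V.
pose ix v := odflt j0 [pick j | (v == col j A) || (v == - col j A)].
have ixE v : v \in V -> v = col (ix v) A \/ v = - col (ix v) A.
  move=> /gen [j vj]; rewrite /ix; case: pickP => [k /orP[]/eqP|/(_ j)]; auto.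
  by rewrite vj.
pose S := [set j in map ix V].
have Sm : (#|S| < m)%N.
  by rewrite (leq_ltn_trans _ Vm) // cardsE (leq_trans (card_size _)) ?size_map.
(* The sign is such that [y] takes the value 1 at a point of [V], be it a column or the opposite of
   one; without opposite pairs in [V] the two demands never clash. *)
pose e j : R := if col j A \in V then 1 else -1.
have e1 j : `|e j| = 1 by rewrite /e; case: ifP; rewrite ?normrN normr1.
have [y [yS yN]] := dual_certificate nsp Sm e1.
have yV v : v \in V -> dotp y v = 1.
  move=> vV; have ixS : ix v \in S by rewrite inE; exact: map_f.
  have := yS _ ixS; rewrite /e; have [<-|vE] := ixE v vV; first by rewrite vV.
  have /negbTE -> : col (ix v) A \notin V.
    by apply/negP => cV; apply: (Vopp v); split; rewrite // {1}vE opprK.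
  by rewrite {2}vE dotpNr => ->; rewrite opprK.
apply: (face_of_certificate (y := y)) => // -[b j] jV.
have [jS|/yN] := boolP (j \in S); last first.
  by rewrite ltr_norml /p => /andP[]; case: b {jV} => /=; rewrite ?dotpNr; lra.
have {jS} [v vV jv] : exists2 v, v \in V & j = ix v.
  by move: jS; rewrite inE => /mapP [v vV ->]; exists v.
(* A generator outside [V] whose index lies in [S] is the opposite of a point of [V], so [y] takes
   the value -1 there. *)
move: jV (yV v vV); rewrite /p jv; have [vE|vE] := ixE v vV; case: b => /=.
- by rewrite -vE dotpNr => _ ->; lra.
- by rewrite -vE vV.
- by rewrite -vE vV.
- by rewrite {2}vE dotpNr; lra.
Qed.

End null_space_property.

(** * From sparse vectors to the null space property *)

Section sparse_to_null_space.
Context {R : realType}.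

Lemma exists_le_average (I : finType) (w g : I -> R) :
  (forall i, 0 <= w i) -> \sum_i w i = 1 -> exists i, g i <= \sum_i w i * g i.
Proof.
move=> w0 w1; apply/not_existsP => H.
have lt i : \sum_i w i * g i < g i by rewrite ltNge; apply/negP/H.
suff : \sum_i w i * g i < \sum_i w i * g i by rewrite ltxx.
have [i wi] : exists i, 0 < w i.
  apply/not_existsP => K; move: w1; rewrite big1 => [/esym/eqP|i _].
    by rewrite oner_eq0.
  by apply/eqP; rewrite eq_le w0 andbT leNgt; apply/negP/K.
rewrite -[X in X < _]mul1r -w1 mulr_suml.
rewrite (bigD1 i) //= [ltRHS](bigD1 i) //=; apply: ltr_leD.
  by rewrite ltr_pM2l.
by apply: ler_sum => j _; apply: ler_wpM2l => //; exact/ltW/lt.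
Qed.

(* Maurey's empirical method, derandomized: the right-hand side is the mean of
   the left-hand side when the [k] vectors [v i] are drawn independently with
   probabilities [w i]. *)
Lemma greedy_sampling (E : lmodType R) (B : E -> E -> R) (I : finType)
    (w : I -> R) (v : I -> E) (h : E) :
  (forall x y, B x y = B y x) ->
  (forall x y z, B (x + y) z = B x z + B y z) ->
  (forall a x y, B (a *: x) y = a * B x y) ->
  (forall i, 0 <= w i) -> \sum_i w i = 1 -> h = \sum_i w i *: v i ->
  forall k z, exists2 s : seq I, size s = k &
    B (z + \sum_(i <- s) v i) (z + \sum_(i <- s) v i) <=
    B z z + 2 * k%:R * B z h + k%:R * (\sum_i w i * B (v i) (v i)) +
      k%:R * (k%:R - 1) * B h h.
Proof.
move=> Bsym BD BZ w0 w1 hE.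
have BDr x y z : B x (y + z) = B x y + B x z by rewrite Bsym BD !(Bsym x).
have Bh x : \sum_i w i * B (v i) x = B h x.
  have B0 y : B 0 y = 0 by rewrite -(scale0r (0 : E)) BZ mul0r.
  rewrite hE (big_morph (B ^~ x) (fun y z => BD y z x) (B0 x)).
  by apply: eq_bigr => i _; rewrite BZ.
elim=> [|k IH] z; first by exists [::] => //; rewrite big_nil addr0 !(mul0r, mulr0) !addr0.
set b := \sum_i w i * B (v i) (v i).
(* The first vector is chosen so that the inductive bound for the remaining [k] draws does not
   exceed its mean. *)
have [i gi] := exists_le_average (fun i => B (z + v i) (z + v i) +
  2 * k%:R * B (z + v i) h + k%:R * b + k%:R * (k%:R - 1) * B h h) w0 w1.
have [s sk sB] := IH (z + v i).
exists (i :: s); first by rewrite /= sk.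
rewrite big_cons addrA; apply: le_trans sB _; apply: le_trans gi _.
rewrite le_eqVlt; apply/orP; left; apply/eqP.
transitivity (B z z + 2 * B h z + b + 2 * k%:R * (B z h + B h h) + k%:R * b +
    k%:R * (k%:R - 1) * B h h); last by rewrite (Bsym h z) -natr1; ring.
transitivity (\sum_i (w i * (B z z + 2 * k%:R * B z h + k%:R * b +
    k%:R * (k%:R - 1) * B h h) + 2 * (w i * B (v i) z) + w i * B (v i) (v i) +
    2 * k%:R * (w i * B (v i) h))).
  by apply: eq_bigr => j _; rewrite !BD !BDr (Bsym z (v j)); ring.
rewrite !big_split /= -mulr_suml w1 -!mulr_sumr !Bh -/b; ring.
Qed.

(** Cauchy-Schwarz against the constant 1, in the form that a variance is nonnegative. *)
Lemma sqr_sum_le (I : finType) (S : {set I}) (u : I -> R) :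
  (\sum_(i in S) u i) ^+ 2 <= #|S|%:R * \sum_(i in S) u i ^+ 2.
Proof.
have [/eqP|S0] := posnP #|S|.
  by rewrite cards_eq0 => /eqP ->; rewrite !big_set0 expr0n mulr0.
set U := \sum_(i in S) u i; pose s : R := #|S|%:R.
have s0 : 0 < s by rewrite ltr0n.
have : 0 <= \sum_(i in S) (s * u i - U) ^+ 2 by apply: sumr_ge0 => i _; exact: sqr_ge0.
have -> : \sum_(i in S) (s * u i - U) ^+ 2 =
    s * (s * (\sum_(i in S) u i ^+ 2) - U ^+ 2).
  transitivity (\sum_(i in S) (s ^+ 2 * u i ^+ 2 - 2 * s * U * u i + U ^+ 2)).
    by apply: eq_bigr => i _; ring.
  rewrite big_split /= sumrB -!mulr_sumr sumr_const -/U -mulr_natl -/s; ring.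
by rewrite pmulr_rge0 // subr_ge0.
Qed.

(** The form [B], that is |Az|^2 - a |z|^2, is nonnegative at [M]-sparse vectors. Sampling [M]
    signed unit vectors with weights |h_i| / H, where H is the l1 norm of [h], gives one with 0 <= M
    (b - a) + M (M - 1) B(hv, hv), and B(hv, hv) = - a |h|^2 / H^2 on the kernel. So |h|^2 is small
    against H^2, whereas a violation of the property makes it large. *)
Lemma null_space_of_sparse (n N m M : nat) (A : 'M[R]_(n, N)) (a b : R) :
  (0 < M)%N -> 0 < a < b ->
  (forall j, dotp (col j A) (col j A) <= b) ->
  (forall z : 'I_N -> R, (#|[set i | z i != 0%R]%SET| <= M)%N ->
     a * \sum_i z i ^+ 2 <=
     dotp (\sum_i z i *: col i A) (\sum_i z i *: col i A)) ->
  9 * (b - a) * m%:R <= (M%:R - 1) * a ->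
  null_space_property m A.
Proof.
move=> M0 /andP[a0 ab] Xb sparse mM S h Sm hA; rewrite leNgt; apply/negP => HS.
pose lin (z : 'cV[R]_N) := \sum_i z i 0 *: col i A.
have linD y z : lin (y + z) = lin y + lin z.
  by rewrite -big_split; apply: eq_bigr => i _; rewrite mxE scalerDl.
have linZ c z : lin (c *: z) = c *: lin z.
  by rewrite scaler_sumr; apply: eq_bigr => i _; rewrite mxE scalerA.
pose B (y z : 'cV[R]_N) := dotp (lin y) (lin z) - a * dotp y z.
pose H := \sum_i `|h i|.
have HE : H = \sum_(i in S) `|h i| + \sum_(i | i \notin S) `|h i|.
  by rewrite /H (bigID (mem S)).
have HSc : 0 <= \sum_(i | i \notin S) `|h i| by apply: sumr_ge0 => i _.
have H0 : 0 < H by rewrite HE; lra.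
pose w i := `|h i| / H.
pose v i : 'cV[R]_N := Num.sg (h i) *: \col_j (j == i)%:R.
have w0 i : 0 <= w i by rewrite divr_ge0 // ltW.
have w1 : \sum_i w i = 1 by rewrite -mulr_suml divff // gt_eqF.
pose hv : 'cV[R]_N := \col_i (h i / H).
have hvE : hv = \sum_i w i *: v i.
  apply/colP => j; rewrite summxE mxE (bigD1 j) //= big1 => [|i ij].
    by rewrite !mxE eqxx mulr1 addr0 /w mulrAC (mulrC `|h j|) mulr_sg_norm.
  by rewrite !mxE eq_sym (negbTE ij) !mulr0.
have [|||s sM] := @greedy_sampling _ B _ w v hv _ _ _ w0 w1 hvE M 0.
- by move=> x y; rewrite /B dotpC (dotpC x).
- by move=> x y z; rewrite /B linD !dotpDl; ring.
- by move=> c x y; rewrite /B linZ !dotpZl; ring.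
have lin0 : lin 0 = 0 by apply: big1 => i _; rewrite mxE scale0r.
have B0 x : B 0 x = 0 by rewrite /B lin0 !dotp0l mulr0 subrr.
rewrite !B0 !add0r mulr0 add0r => Bs.
set Z := \sum_(i <- s) v i in Bs.
have Bs0 : 0 <= B Z Z.
  rewrite subr_ge0 /dotp.
  have -> : \sum_i Z i 0 * Z i 0 = \sum_i (Z i 0) ^+ 2 by [].
  apply: sparse; rewrite -sM (leq_trans _ (card_size s)) //.
  apply/subset_leq_card/fintype.subsetP => i; rewrite inE; apply: contraR => iNs.
  rewrite /Z summxE big_seq big1 // => j js; rewrite !mxE.
  by rewrite (_ : i == j = false) ?mulr0 //; apply: contraNF iNs => /eqP ->.
(* A zero coordinate has sign 0, but then its weight is 0 as well. *)
have vv i : w i * B (v i) (v i) <= w i * (b - a).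
  have [hi|hi] := eqVneq (h i) 0; first by rewrite /w hi normr0 !mul0r.
  apply: ler_wpM2l => //; rewrite /B lerB //.
    rewrite linZ dotpZl dotpZr mulrA -expr2 sqr_sg hi mul1r.
    suff -> : lin (\col_j (j == i)%:R) = col i A by [].
    rewrite /lin (bigD1 i) //= mxE eqxx scale1r big1 ?addr0 // => j /negbTE ji.
    by rewrite mxE ji scale0r.
  rewrite dotpZl dotpZr !mulrA -(mulrA a) -expr2 sqr_sg hi mulr1.
  rewrite -[leLHS]mulr1 ler_pM2l // /dotp (bigD1 i) //= !mxE eqxx mulr1.
  by rewrite lerDl sumr_ge0 // => j _; rewrite -expr2 sqr_ge0.
have bE : \sum_i w i * B (v i) (v i) <= b - a.
  by rewrite -[leRHS]mul1r -w1 mulr_suml; apply: ler_sum => i _; exact: vv.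
pose q := \sum_i h i ^+ 2.
have hh : B hv hv = - (a * q / H ^+ 2).
  have lin_hv : lin hv = 0.
    rewrite /lin -[RHS](scaler0 _ H^-1) -[in RHS]hA scaler_sumr.
    by apply: eq_bigr => i _; rewrite mxE scalerA mulrC.
  rewrite /B lin_hv dotp0l sub0r /dotp -mulrA /q mulr_suml.
  by congr (- (_ * _)); apply: eq_bigr => i _; rewrite mxE -expr2 expr_div_n.
have key : (M%:R - 1) * a * q <= (b - a) * H ^+ 2.
  have H2 : 0 < H ^+ 2 by rewrite exprn_gt0.
  have := le_trans Bs0 Bs; rewrite hh -mulrA -mulrDr pmulr_rge0 ?ltr0n // => K.
  have {K} : 0 <= (b - a) + (M%:R - 1) * - (a * q / H ^+ 2) by lra.
  by rewrite mulrN subr_ge0 !mulrA ler_pdivrMr // -(mulrA (b - a)) -expr2.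
have q0 : 0 <= q by apply: sumr_ge0 => i _; exact: sqr_ge0.
(* A violation leaves less than two thirds of [H] outside [S], so [H] is less than 3 times the part
   on [S]; hence 9. *)
have HS2 : H ^+ 2 < 9 * m%:R * q.
  have S1 : (\sum_(i in S) `|h i|) ^+ 2 <= m%:R * q.
    apply: le_trans (sqr_sum_le _ _) _; apply: ler_pM => //.
    - by apply: sumr_ge0 => i _; exact: sqr_ge0.
    - by rewrite ler_nat ltnW.
    - rewrite /q [leRHS](bigID (mem S)) /= -[leLHS]addr0 lerD //.
        by apply: ler_sum => i _; rewrite real_normK ?num_real.
      by apply: sumr_ge0 => i _; exact: sqr_ge0.
  have : H < 3 * \sum_(i in S) `|h i| by rewrite HE; lra.
  move=> H3; have : H ^+ 2 < (3 * \sum_(i in S) `|h i|) ^+ 2.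
    by rewrite ltr_pXn2r // nnegrE ?ltW // (lt_trans H0).
  rewrite exprMn; lra.
have K1 : (b - a) * H ^+ 2 < (b - a) * (9 * m%:R * q) by rewrite ltr_pM2l ?subr_gt0.
have K2 : 9 * (b - a) * m%:R * q <= (M%:R - 1) * a * q by apply: ler_wpM2r.
have := le_lt_trans key K1; rewrite ltNge => /negP; apply.
by rewrite (le_trans _ K2) // le_eqVlt; apply/orP; left; apply/eqP; ring.
Qed.

End sparse_to_null_space.

(** * The off-diagonal quadratic form *)

Section off_diagonal.
Context {R : realType} {n N : nat} (X : 'I_N -> 'cV[R]_n).

Definition off_diag (z : 'I_N -> R) : R :=
  \sum_i \sum_(j | j != i) z i * z j * dotp (X i) (X j).

Lemma dotp_lin (z : 'I_N -> R) :
  dotp (\sum_i z i *: X i) (\sum_i z i *: X i) =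
  \sum_i z i ^+ 2 * dotp (X i) (X i) + off_diag z.
Proof.
rewrite /off_diag -big_split dotp_suml; apply: eq_bigr => i _ /=.
rewrite dotp_sumr (bigD1 i) //= dotpZl dotpZr mulrA -expr2; congr (_ + _).
by apply: eq_bigr => j _; rewrite dotpZl dotpZr mulrA.
Qed.

Lemma off_diagZ a (z : 'I_N -> R) : off_diag (fun i => a * z i) = a ^+ 2 * off_diag z.
Proof.
rewrite /off_diag mulr_sumr; apply: eq_bigr => i _; rewrite mulr_sumr.
by apply: eq_bigr => j _; ring.
Qed.

Lemma eq_off_diag (y z : 'I_N -> R) : y =1 z -> off_diag y = off_diag z.
Proof. by move=> /funext ->. Qed.

Definition upd (z : 'I_N -> R) (i : 'I_N) (t : R) (j : 'I_N) :=
  if j == i then t else z j.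

(** No product in the form contains the same coordinate twice. *)
Lemma off_diag_affine z i t u s :
  off_diag (upd z i (t + s * (u - t))) =
  off_diag (upd z i t) + s * (off_diag (upd z i u) - off_diag (upd z i t)).
Proof.
rewrite /off_diag -sumrB mulr_sumr -big_split; apply: eq_bigr => j _ /=.
rewrite -sumrB mulr_sumr -big_split; apply: eq_bigr => k kj /=.
rewrite /upd; case: (eqVneq j i) kj => [->|_] => [/negbTE ->|_]; first by ring.
by case: (eqVneq k i) => _; ring.
Qed.

Lemma off_diag_endpoint z i t u : t <= z i <= u ->
  off_diag (upd z i t) <= off_diag z \/ off_diag (upd z i u) <= off_diag z.
Proof.
move=> /andP[tz zu]; have [tu|tu] := eqVneq t u.
  left; have zt : z i = t by apply/eqP; rewrite eq_le tz tu zu.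
  by rewrite (@eq_off_diag _ z) // => j; rewrite /upd; case: eqP => // ->.
have ut : 0 < u - t by rewrite subr_gt0 lt_neqAle tu (le_trans tz).
pose s := (z i - t) / (u - t).
have zE : z i = t + s * (u - t) by rewrite /s mulrVK ?unitfE ?gt_eqF //; ring.
have -> : off_diag z = off_diag (upd z i (t + s * (u - t))).
  by apply: eq_off_diag => j; rewrite /upd -zE; case: eqP => // ->.
rewrite off_diag_affine.
have s0 : 0 <= s by rewrite /s divr_ge0 ?(ltW ut) // subr_ge0.
have s1 : s <= 1 by rewrite /s ler_pdivrMr // mul1r lerB.
have [h|h] := leP (off_diag (upd z i t)) (off_diag (upd z i u)); [left|right].
  by rewrite lerDl mulr_ge0 // subr_ge0.
have : (1 - s) * (off_diag (upd z i u) - off_diag (upd z i t)) <= 0.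
  by rewrite mulr_ge0_le0 ?subr_ge0 // subr_le0 ltW.
lra.
Qed.

(* The off-diagonal form is affine in each coordinate separately. *)
Lemma off_diag_vertex (z lo hi : 'I_N -> R) : (forall i, lo i <= z i <= hi i) ->
  exists b : 'I_N -> bool,
    off_diag (fun i => if b i then lo i else hi i) <= off_diag z.
Proof.
move=> lzh.
suff [x xz xlh] : exists2 x, off_diag x <= off_diag z & forall i,
    [/\ i \in enum 'I_N -> x i = lo i \/ x i = hi i &
        i \notin enum 'I_N -> x i = z i].
  have xE i : exists b : bool, x i = if b then lo i else hi i.
    by case: (xlh i) => /(_ (mem_enum _ _))[->|->] _; [exists true|exists false].
  have [b bE] := choice xE.
  by exists b; rewrite (@eq_off_diag _ x) // => i; rewrite bE.
elim: (enum 'I_N) (enum_uniq 'I_N) => [_|i s IH /= /andP[iNs us]].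
  by exists z => // i; split.
have [x xz xlh] := IH us.
have xi : x i = z i by case: (xlh i) => _; exact.
have [] := @off_diag_endpoint x i (lo i) (hi i); first by rewrite xi.
all: move=> h; eexists; first exact: le_trans h xz.
all: move=> j; rewrite /upd inE; case: eqP => [->|_ /=]; [split=> //; auto|exact: xlh].
Qed.

End off_diagonal.

(** * Rounding sparse vectors to dyadic ones *)

Section dyadic.
Context {R : realType} (L : nat).

(* [None] codes 0 and [Some (s, l)] codes the number 2^-l with sign (-1)^s. *)
Definition dyad (c : option (bool * 'I_L.+1)) : R :=
  if c is Some (s, l) then (-1) ^+ s * 2^-1 ^+ l else 0.

Lemma sqr_dyad s l : dyad (Some (s, l)) ^+ 2 = 4^-1 ^+ l.
Proof.
rewrite /dyad exprMn sqrr_sign mul1r -exprM mulnC exprM; congr (_ ^+ _).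
by rewrite expr2; field.
Qed.

Lemma norm_dyad s l : `|dyad (Some (s, l))| = 2^-1 ^+ l.
Proof. by rewrite /dyad normrMsign ger0_norm // exprn_ge0 // invr_ge0. Qed.

Lemma dyad_scale (u : R) : 2^-1 ^+ L < `|u| -> `|u| <= 1 ->
  exists2 l, (l < L)%N & 2^-1 ^+ l.+1 <= `|u| <= 2^-1 ^+ l.
Proof.
elim: L => [|k IH]; first by rewrite expr0 ltNge => /negbTE ->.
move=> ku u1; have [uk|uk] := leP `|u| (2^-1 ^+ k).
  by exists k => //; rewrite uk andbT ltW.
by have [l lk H] := IH uk u1; exists l => //; exact: ltnW.
Qed.

(** A number beyond 2^-L in modulus is enclosed by two consecutive powers of 2 with its sign, a
    smaller nonzero one by -2^-L and 2^-L, and 0 by itself. So supports do not grow, and the excess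
    4^-L is paid on the support only. *)
Lemma dyadic_interval (u : R) : `|u| <= 1 ->
  exists lh, [/\ dyad lh.1 <= u <= dyad lh.2,
    dyad lh.1 ^+ 2 <= 4 * u ^+ 2 + (u != 0)%:R * 4^-1 ^+ L &
    dyad lh.2 ^+ 2 <= 4 * u ^+ 2 + (u != 0)%:R * 4^-1 ^+ L].
Proof.
move=> u1; have [->|u0] := eqVneq u 0.
  by exists (None, None); rewrite /dyad /= !expr0n /= mulr0 mul0r addr0 lexx.
rewrite mul1r.
have q0 l : 0 <= (4^-1 : R) ^+ l by rewrite exprn_ge0 // invr_ge0.
have [uL|uL] := leP `|u| (2^-1 ^+ L).
  exists (Some (true, ord_max), Some (false, ord_max)).
  rewrite !sqr_dyad lerDr mulr_ge0 ?sqr_ge0 //; split => //.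
  by rewrite /dyad /= expr1 expr0 mulN1r mul1r -ler_norml.
have [l lL /andP[ul lu]] := dyad_scale uL u1.
have lL1 : (l < L.+1)%N by exact: ltnW.
have sq k : (2^-1 : R) ^+ k ^+ 2 = 4^-1 ^+ k.
  by rewrite -exprM mulnC exprM; congr (_ ^+ _); rewrite expr2; field.
have u2 : 4^-1 ^+ l <= 4 * u ^+ 2 :> R.
  have : (2^-1 : R) ^+ l.+1 ^+ 2 <= `|u| ^+ 2.
    by rewrite lerXn2r // nnegrE // exprn_ge0 // invr_ge0.
  by rewrite sq exprS real_normK ?num_real // => H; lra.
have u3 : 4^-1 ^+ l.+1 <= 4 * u ^+ 2 :> R.
  by rewrite (le_trans _ u2) // exprS; have := q0 l; lra.
have uw x : x <= 4 * u ^+ 2 -> x <= 4 * u ^+ 2 + 4^-1 ^+ L.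
  by move=> h; rewrite (le_trans h) // lerDl.
have [un|up] := ltP u 0.
  exists (Some (true, Ordinal lL1), Some (true, Ordinal (lL : (l.+1 < L.+1)%N))).
  rewrite !sqr_dyad; split; [|exact: uw|exact: uw].
  by move: ul lu; rewrite ltr0_norm // /dyad /= expr1 !mulN1r lerNl lerNr => -> ->.
exists (Some (false, Ordinal (lL : (l.+1 < L.+1)%N)), Some (false, Ordinal lL1)).
rewrite !sqr_dyad; split; [|exact: uw|exact: uw].
by move: ul lu; rewrite ger0_norm // /dyad /= expr0 !mul1r => -> ->.
Qed.

End dyadic.

Section dyadic_rounding.
Context {R : realType} {n N : nat} (X : 'I_N -> 'cV[R]_n) (L : nat).

Definition dyads (f : {ffun 'I_N -> option (bool * 'I_L.+1)}) (i : 'I_N) : R :=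
  dyad (f i).

(** Scaled to unit length, [z] lies in a box with dyadic vertices, and the form is no larger at one
    of them. The 5 is 4 from rounding within a factor 2, plus 1 from at most 4^L coordinates with
    excess 4^-L each. *)
Lemma off_diag_dyadic (e : R) :
  (forall f, \sum_i dyads f i ^+ 2 <= 5 -> - e <= off_diag X (dyads f)) ->
  forall z : 'I_N -> R, (#|[set i | z i != 0%R]%SET| <= 4 ^ L)%N ->
    - e * \sum_i z i ^+ 2 <= off_diag X z.
Proof.
move=> He z zL; set q := \sum_i z i ^+ 2.
have zq i : z i ^+ 2 <= q.
  by rewrite /q (bigD1 i) //= lerDl sumr_ge0 // => j _; exact: sqr_ge0.
have [q0|q0] : q = 0 \/ 0 < q.
- have : 0 <= q by apply: sumr_ge0 => i _; exact: sqr_ge0.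
  by rewrite le_eqVlt => /orP[/eqP <-|]; [left|right].
- rewrite q0 mulr0 /off_diag big1 // => i _; rewrite big1 // => j _.
  have /eqP : z i ^+ 2 = 0 by apply/eqP; rewrite eq_le sqr_ge0 -q0 zq.
  by rewrite sqrf_eq0 => /eqP ->; rewrite !mul0r.
pose u i := (Num.sqrt q)^-1 * z i.
have u2 : \sum_i u i ^+ 2 = 1.
  under eq_bigr do rewrite exprMn exprVn sqr_sqrtr ?(ltW q0) //.
  by rewrite -mulr_sumr -/q mulVf // gt_eqF.
have u1 i : `|u i| <= 1.
  rewrite -(ler_pXn2r (n := 2)) ?nnegrE // expr1n real_normK ?num_real // -u2.
  by rewrite (bigD1 i) //= lerDl sumr_ge0 // => j _; exact: sqr_ge0.
have [lh lhE] := choice (fun i => dyadic_interval L (u1 i)).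
have [i|b bE] := @off_diag_vertex _ _ _ X u (fun i => dyad (lh i).1)
  (fun i => dyad (lh i).2); first by case: (lhE i).
pose f := [ffun i => if b i then (lh i).1 else (lh i).2].
have fE : dyads f =1 (fun i => if b i then dyad (lh i).1 else dyad (lh i).2).
  by move=> i; rewrite /dyads ffunE; case: ifP.
have f5 : \sum_i dyads f i ^+ 2 <= 5.
  apply: le_trans (_ : \sum_i (4 * u i ^+ 2 + (u i != 0)%:R * 4^-1 ^+ L) <= _).
    by apply: ler_sum => i _; rewrite fE; case: (lhE i) => _; case: ifP.
  have cE : (\sum_i (u i != 0%R) = #|[set i | u i != 0%R]%SET|)%N.
    by rewrite -sum1dep_card [RHS]big_mkcond; apply: eq_bigr => i _; case: (_ != _).
  rewrite big_split /= -mulr_sumr u2 -mulr_suml -natr_sum cE.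
  suff : #|[set i | u i != 0%R]%SET|%:R * 4^-1 ^+ L <= 1 :> R by lra.
  rewrite exprVn ler_pdivrMr ?exprn_gt0 // mul1r -natrX ler_nat.
  apply: leq_trans zL; apply/subset_leq_card/fintype.subsetP => i; rewrite !inE.
  by rewrite /u; apply: contraNN => /eqP ->; rewrite mulr0.
have := le_trans (He f f5) _; rewrite (eq_off_diag X fE) => /(_ _ bE).
by rewrite off_diagZ exprVn sqr_sqrtr ?(ltW q0) // ler_pdivlMl // mulrC.
Qed.

End dyadic_rounding.

(** * Levels and pasts of a dyadic vector *)

Section dyadic_chaos.
Context {R : realType} {n N : nat} (X : 'I_N -> 'cV[R]_n) (L : nat).
Notation code := ({ffun 'I_N -> option (bool * 'I_L.+1)}).
Implicit Types (f : code) (i j : 'I_N) (l : 'I_L.+1).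

Definition level f l : {set 'I_N} :=
  [set j | if f j is Some (_, k) then k == l else false]%SET.

(* Ordering the support by (level, index) makes each product of two distinct
   coordinates an interaction of a column with its past; this replaces
   decoupling. *)
Definition precedes f i j : bool :=
  match f i, f j with
  | Some (_, k), Some (_, l) => (k < l)%N || (k == l) && (i < j)%N
  | _, _ => false
  end.

Definition past f j : 'cV[R]_n := \sum_(i | precedes f i j) dyads f i *: X i.

(** Level [l] and its pasts see only the levels up to [l], so the union bound at this level may run
    over truncated codes, which are far fewer. *)
Definition truncate f l : code :=
  [ffun i => if f i is Some (s, k) then if (k <= l)%N then Some (s, k) else None
             else None].

(** Of two distinct coordinates in the support exactly one precedes the other, and the form is
    symmetric. *)
Lemma off_diag_past f :
  off_diag X (dyads f) = 2 * \sum_j dyads f j * dotp (X j) (past f j).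
Proof.
pose t i j := dyads f i * dyads f j * dotp (X i) (X j).
have tC i j : t i j = t j i by rewrite /t (mulrC (dyads f i)) dotpC.
have -> : \sum_j dyads f j * dotp (X j) (past f j) =
    \sum_j \sum_i (precedes f i j)%:R * t i j.
  apply: eq_bigr => j _; rewrite dotp_sumr mulr_sumr big_mkcond.
  apply: eq_bigr => i _; case: ifP => _; last by rewrite mul0r.
  by rewrite mul1r dotpZr tC /t; ring.
have -> : off_diag X (dyads f) =
    \sum_i \sum_j ((precedes f i j)%:R * t i j + (precedes f j i)%:R * t j i).
  apply: eq_bigr => i _; rewrite [RHS](bigD1 i) //= [X in X + _](_ : _ = 0).
    rewrite add0r; apply: eq_bigr => j ji; rewrite (tC j i) -mulrDl.
    rewrite -/(t i j) /precedes /t /dyads.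
    case: (f i) => [[s k]|]; case: (f j) => [[s' l]|];
      rewrite /dyad ?mul0r ?mulr0 ?mul0r ?addr0 ?mulr0 //.
    suff -> : (((k < l)%N || (k == l) && (i < j)%N)%:R +
       ((l < k)%N || (l == k) && (j < i)%N)%:R : R) = 1 by rewrite mul1r.
    have ij : (i < j)%N != (j < i)%N.
      by case: ltngtP ji => // /val_inj ->; rewrite eqxx.
    rewrite -!(inj_eq val_inj) /=.
    by case: (ltngtP k l) => _ /=; case: ltngtP ij; rewrite ?addr0 ?add0r.
  rewrite /precedes; case: (f i) => [[s k]|]; last by rewrite !mul0r addr0.
  by rewrite !ltnn andbF !mul0r addr0.
under eq_bigr do rewrite big_split.
by rewrite big_split /= exchange_big /= mulr_natl mulr2n.
Qed.

Lemma sum_by_level f (g : 'I_L.+1 -> R) (u : 'I_N -> R) :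
  \sum_j (if f j is Some (_, k) then g k else 0) * u j =
  \sum_(l < L.+1) g l * \sum_(j in level f l) u j.
Proof.
under [RHS]eq_bigr do rewrite mulr_sumr big_mkcond.
rewrite exchange_big /=; apply: eq_bigr => j _.
case fj : (f j) => [[s k]|]; last first.
  by rewrite mul0r big1 // => l _; rewrite inE fj.
rewrite (bigD1 k) //= inE fj eqxx big1 ?addr0 // => l lk.
by rewrite inE fj eq_sym (negbTE lk).
Qed.

Lemma sum_levels f (u : 'I_N -> R) :
  \sum_j `|dyads f j| * u j = \sum_(l < L.+1) 2^-1 ^+ l * \sum_(j in level f l) u j.
Proof.
rewrite -sum_by_level; apply: eq_bigr => j _; rewrite /dyads.
by case: (f j) => [[s k]|]; rewrite ?norm_dyad // /dyad normr0.
Qed.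

Lemma sum_dyads_sqr f :
  \sum_j (dyads f j : R) ^+ 2 = \sum_(l < L.+1) 4^-1 ^+ l * #|level f l|%:R.
Proof.
under eq_bigr do rewrite -real_normK ?num_real // expr2.
rewrite (sum_levels f (fun j => `|dyads f j|)); apply: eq_bigr => l _.
rewrite (eq_bigr (fun=> 2^-1 ^+ l)) => [|j]; last first.
  rewrite inE /dyads; case: (f j) => [[s k]|] // /eqP ->; exact: norm_dyad.
rewrite sumr_const mulrnAr mulr1 mulrnAr; congr (_ *+ _).
by rewrite -exprMn; congr (_ ^+ _); field.
Qed.

Lemma card_level f l (b : R) : \sum_j dyads f j ^+ 2 <= b ->
  #|level f l|%:R <= b * 4 ^+ l.
Proof.
rewrite sum_dyads_sqr => fb; rewrite -ler_pdivrMr ?exprn_gt0 // (le_trans _ fb) //.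
by rewrite (bigD1 l) //= exprVn mulrC lerDl sumr_ge0.
Qed.

Lemma level_truncate f l : level (truncate f l) l = level f l.
Proof.
apply/setP => j; rewrite !inE ffunE; case: (f j) => [[s k]|] //.
case: (leqP k l) => // lk; apply/esym/negbTE; apply: contraTN lk => /eqP ->.
by rewrite ltnn.
Qed.

Lemma past_truncate f l j : j \in level f l -> past (truncate f l) j = past f j.
Proof.
rewrite inE; case fj : (f j) => [[s k]|] // /eqP kl; subst k.
have tj : truncate f l j = Some (s, l) by rewrite ffunE fj leqnn.
have E i : precedes (truncate f l) i j = precedes f i j.
  rewrite /precedes tj fj ffunE; case: (f i) => [[s' k]|] //.
  by case: (leqP k l) => // lk; rewrite ltnNge ltnW //= -(inj_eq val_inj) gtn_eqF.
rewrite /past; apply: eq_big => // i; rewrite E => ij.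
congr (_ *: _); move: ij; rewrite /precedes fj /dyads ffunE.
case: (f i) => [[s' k]|] //; case: (leqP k l) => // lk.
by rewrite ltnNge ltnW //= -(inj_eq val_inj) gtn_eqF.
Qed.

(** Every past is the image of such a restriction, so a bound on the images of all codes with square
    sum at most 5 covers the pasts too. *)
Definition mask_code (Q : pred 'I_N) f : code := [ffun i => if Q i then f i else None].

Lemma dyads_mask Q f i : dyads (mask_code Q f) i = if Q i then dyads f i else 0 :> R.
Proof. by rewrite /dyads ffunE; case: ifP. Qed.

Lemma sum_sqr_mask Q f :
  \sum_i (dyads (mask_code Q f) i : R) ^+ 2 <= \sum_i dyads f i ^+ 2.
Proof.
apply: ler_sum => i _; rewrite dyads_mask; case: ifP => // _.
by rewrite expr0n sqr_ge0.
Qed.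

Lemma sum_sqr_truncate f l :
  \sum_i (dyads (truncate f l) i : R) ^+ 2 <= \sum_i dyads f i ^+ 2.
Proof.
apply: ler_sum => i _; rewrite /dyads ffunE; case: (f i) => [[s k]|] //.
by case: ifP => // _; rewrite expr0n sqr_ge0.
Qed.

Lemma past_mask f j :
  past f j = \sum_i dyads (mask_code (precedes f ^~ j) f) i *: X i.
Proof.
rewrite /past big_mkcond; apply: eq_bigr => i _; rewrite dyads_mask.
by case: ifP => // _; rewrite scale0r.
Qed.

(** Either [s] is at most Lam^(1/r), or the quotient of the two is at least 1 and hence below its
    r-th power. This converts control of r-th powers into control of the plain sum. *)
Lemma le_rpow_average (s r Lam : R) : 0 <= s -> 1 <= r -> 0 < Lam ->
  s <= Lam `^ r^-1 * (1 + s `^ r / Lam).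
Proof.
move=> s0 r1 Lam0; set A := Lam `^ r^-1.
have A0 : 0 < A by rewrite powR_gt0.
have r0 : r != 0 by rewrite gt_eqF // (lt_le_trans ltr01).
have AE : A `^ r = Lam by rewrite -powRrM mulVf // powRr1 // ltW.
have [sA|sA] := leP s A.
  apply: le_trans sA _; rewrite ler_peMr ?(ltW A0) // lerDl.
  by rewrite divr_ge0 ?powR_ge0 ?(ltW Lam0).
rewrite -ler_pdivrMl // mulrC.
have u1 : 1 <= s / A by rewrite ler_pdivlMr // mul1r ltW.
have : s / A <= (s / A) `^ r.
  rewrite -[leLHS]powRr1; last by rewrite (le_trans ler01).
  exact: ler_powR.
have -> : (s / A) `^ r = s `^ r / Lam.
  have sA0 : 0 <= s / A by rewrite divr_ge0 // ltW.
  apply: canRL (mulfK _) _; first by rewrite gt_eqF.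
  by rewrite -[in LHS]AE -powRM ?(ltW A0) // divfK // gt_eqF.
by move=> h; rewrite (le_trans h) // lerDr ler01.
Qed.

(* When the past vanishes the quotient is 0 / 0 = 0, as wanted. *)
Definition tamed (psi r tau : R) f l :=
  \sum_(j in level f l)
    (`|dotp (X j) (past f j)| / (psi * enorm (past f j))) `^ r <= tau.

Lemma tamed_truncate psi r tau f l :
  tamed psi r tau (truncate f l) l -> tamed psi r tau f l.
Proof.
rewrite /tamed level_truncate => h; apply: le_trans h.
rewrite le_eqVlt; apply/orP; left; apply/eqP.
by apply: eq_bigr => j jl; rewrite past_truncate.
Qed.

Lemma tamed_level psi r Lam tau S f l : 0 < psi -> 1 <= r -> 0 < Lam -> 0 <= S ->
  tamed psi r (tau * Lam) f l -> (forall j, enorm (past f j) <= S) ->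
  \sum_(j in level f l) `|dotp (X j) (past f j)| <=
  psi * S * Lam `^ r^-1 * (#|level f l|%:R + tau).
Proof.
move=> psi0 r1 Lam0 S0 tam wS.
pose s j := `|dotp (X j) (past f j)| / (psi * enorm (past f j)).
have s0 j : 0 <= s j.
  by rewrite /s divr_ge0 // mulr_ge0 ?enorm_ge0 // ltW.
have pS : 0 <= psi * S by rewrite mulr_ge0 // ltW.
have sE j : `|dotp (X j) (past f j)| <= s j * (psi * S).
  have [w0|w0] := eqVneq (enorm (past f j)) 0.
    by rewrite (enorm0_eq0 w0) dotp0r normr0 mulr_ge0.
  have w1 : 0 < psi * enorm (past f j).
    by rewrite mulr_gt0 // lt_neqAle eq_sym w0 enorm_ge0.
  rewrite -[leLHS](divfK (lt0r_neq0 w1)) -/(s j) ler_wpM2l //.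
  by rewrite ler_wpM2l // ltW.
apply: le_trans (_ : \sum_(j in level f l)
  (Lam `^ r^-1 * (1 + s j `^ r / Lam)) * (psi * S) <= _).
  apply: ler_sum => j _; apply: le_trans (sE j) _; apply: ler_wpM2r => //.
  exact: le_rpow_average.
rewrite -mulr_suml -mulr_sumr big_split /= sumr_const -mulr_suml.
rewrite [leLHS]mulrC -[leRHS]mulrA ler_wpM2l // ler_wpM2l ?powR_ge0 //.
by rewrite lerD2l ler_pdivrMr.
Qed.

End dyadic_chaos.

(** * Deterministic bound on the off-diagonal form *)

Section dyadic_chaos_bound.
Context {R : realType}.

Lemma sum_pow2 (L : nat) : \sum_(l < L.+1) 2 ^+ l <= 2 * 2 ^+ L :> R.
Proof.
elim: L => [|L IH]; first by rewrite big_ord1 expr0; lra.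
by rewrite big_ord_recr /= exprS; lra.
Qed.

Lemma sum_pow2V (L : nat) : \sum_(l < L.+1) 2^-1 ^+ l <= 2 :> R.
Proof.
suff -> : \sum_(l < L.+1) 2^-1 ^+ l = 2 - 2^-1 ^+ L :> R.
  by rewrite lerBlDr lerDl exprn_ge0 // invr_ge0.
elim: L => [|L IH]; first by rewrite big_ord1 expr0; lra.
by rewrite big_ord_recr /= IH exprS; field.
Qed.

Lemma sum_pow2_linear (L : nat) :
  \sum_(l < L.+1) 2 ^+ l * (L.+1 - l)%:R <= 4 * 2 ^+ L :> R.
Proof.
elim: L => [|L IH]; first by rewrite big_ord1 expr0 subn0; lra.
rewrite (eq_bigr (fun l : 'I_L.+2 => 2 ^+ l * (L.+1 - l)%:R + 2 ^+ l)); last first.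
  move=> l _; have -> : (L.+2 - l)%:R = (L.+1 - l)%:R + 1 :> R.
    by rewrite natr1 -subSn // -ltnS.
  by rewrite mulrDr mulr1.
rewrite big_split /= big_ord_recr /= subnn mulr0 addr0.
by have := sum_pow2 L.+1; rewrite (exprS _ L); lra.
Qed.

(* The first summand beats the entropy of the codes of depth [l], the second one
   is what the failure probability exp(- 2^L Lam) costs. *)
Definition budget (L l : nat) : R := 40 * 4 ^+ l * (L.+1 - l)%:R + 2 ^+ L.

Context {n N : nat} (X : 'I_N -> 'cV[R]_n) (L : nat).
Notation code := ({ffun 'I_N -> option (bool * 'I_L.+1)}).

Lemma off_diag_tamed (psi r Lam S : R) (f : code) :
  0 < psi -> 1 <= r -> 0 < Lam -> 0 <= S ->
  \sum_i (dyads f i : R) ^+ 2 <= 5 ->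
  (forall g : code, \sum_i (dyads g i : R) ^+ 2 <= 5 ->
     enorm (\sum_i dyads g i *: X i) <= S) ->
  (forall l : 'I_L.+1, tamed X psi r (budget L l * Lam) f l) ->
  `|off_diag X (dyads f)| <= 344 * (psi * S * Lam `^ r^-1 * 2 ^+ L).
Proof.
move=> psi0 r1 Lam0 S0 f5 gS tam.
have pastS j : enorm (past X f j) <= S.
  by rewrite past_mask gS // (le_trans (sum_sqr_mask _ _)).
rewrite off_diag_past normrM ger0_norm //.
set B := psi * S * Lam `^ r^-1.
have B0 : 0 <= B by rewrite !mulr_ge0 ?powR_ge0 ?(ltW psi0).
(* The three summands of [lev] contribute 5 times 2, 40 times 4 and 2, that is 172, each against
   2^L. *)
suff H : `|\sum_j dyads f j * dotp (X j) (past X f j)| <= 172 * (B * 2 ^+ L) by lra.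
apply: le_trans (ler_norm_sum _ _ _) _.
rewrite (eq_bigr (fun j => `|dyads f j| * `|dotp (X j) (past X f j)|)); last first.
  by move=> j _; rewrite normrM.
rewrite (sum_levels f (fun j => `|dotp (X j) (past X f j)|)).
have lev (l : 'I_L.+1) : 2^-1 ^+ l * \sum_(j in level f l) `|dotp (X j) (past X f j)|
    <= B * (5 * 2 ^+ l + 40 * (2 ^+ l * (L.+1 - l)%:R) + 2 ^+ L * 2^-1 ^+ l).
  have q0 : 0 <= (2^-1 : R) ^+ l by rewrite exprn_ge0 // invr_ge0.
  apply: le_trans (ler_wpM2l q0 (tamed_level psi0 r1 Lam0 S0 (tam l) pastS)) _.
  rewrite -/B mulrCA ler_wpM2l //.
  apply: le_trans (_ : 2^-1 ^+ l * (5 * 4 ^+ l + budget L l) <= _).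
    by rewrite ler_wpM2l // lerD2r card_level.
  have -> : 2 ^+ l = 2^-1 ^+ l * 4 ^+ l :> R.
    by rewrite -exprMn; congr (_ ^+ _); field.
  by rewrite /budget le_eqVlt; apply/orP; left; apply/eqP; ring.
apply: le_trans (ler_sum _ (fun l _ => lev l)) _.
rewrite -mulr_sumr mulrCA ler_wpM2l // !big_split /= -!mulr_sumr.
have := sum_pow2 L; have := sum_pow2V L; have := sum_pow2_linear L.
set a := \sum_(l < L.+1) 2^-1 ^+ l => h1 h2 h3.
have : 2 ^+ L * a <= 2 ^+ L * 2 by rewrite ler_wpM2l // exprn_ge0.
lra.
Qed.

(** A bootstrap: with [S] the maximal length of an image, the form is at most s S / 16, whence S^2
    <= 25/4 s^2 + s S / 16. This forces S <= 4 s, and the form is then at most s^2 / 4. *)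
Lemma off_diag_tamed_small (psi r Lam s : R) :
  0 < psi -> 1 <= r -> 0 < Lam -> 0 <= s ->
  (forall i, dotp (X i) (X i) <= 5 / 4 * s ^+ 2) ->
  (forall (f : code) (l : 'I_L.+1), \sum_i (dyads f i : R) ^+ 2 <= 5 ->
     tamed X psi r (budget L l * Lam) f l) ->
  344 * (psi * Lam `^ r^-1 * 2 ^+ L) <= s / 16 ->
  forall f : code, \sum_i (dyads f i : R) ^+ 2 <= 5 ->
    `|off_diag X (dyads f)| <= s ^+ 2 / 4.
Proof.
move=> psi0 r1 Lam0 s0 Xs tam small.
pose D (f : code) := \sum_i (dyads f i : R) ^+ 2 <= 5.
pose z0 : code := [ffun=> None].
have Dz0 : D z0.
  by rewrite /D big1 // => i _; rewrite /dyads ffunE /= expr0n.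
pose nrm (f : code) : R := enorm (\sum_i dyads f i *: X i).
have [g0 Dg0 gmax] := @arg_maxP _ R code z0 D nrm Dz0.
set S := nrm g0 in gmax.
have S0 : 0 <= S by exact: enorm_ge0.
have off f : D f -> `|off_diag X (dyads f)| <= s / 16 * S.
  move=> Df; apply: le_trans (off_diag_tamed psi0 r1 Lam0 S0 Df gmax _) _.
    by move=> l; apply: tam.
  rewrite (_ : _ * _ = 344 * (psi * Lam `^ r^-1 * 2 ^+ L) * S); last by ring.
  exact: ler_wpM2r.
have S2 : S ^+ 2 <= 25 / 4 * s ^+ 2 + s / 16 * S.
  rewrite /S /nrm sqr_enorm dotp_lin; apply: lerD; last first.
    by rewrite (le_trans (ler_norm _)) // off.
  apply: le_trans (_ : \sum_i dyads g0 i ^+ 2 * (5 / 4 * s ^+ 2) <= _).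
    by apply: ler_sum => i _; rewrite ler_wpM2l // sqr_ge0.
  rewrite -mulr_suml; apply: le_trans (_ : 5 * (5 / 4 * s ^+ 2) <= _); last by lra.
  by rewrite ler_wpM2r // mulr_ge0 ?sqr_ge0.
have S4 : S <= 4 * s.
  rewrite leNgt; apply/negP => sS.
  have : s * S <= S ^+ 2 / 4 by rewrite expr2 mulrAC ler_wpM2r //; lra.
  have : s ^+ 2 <= S ^+ 2 / 16 by rewrite !expr2; nra.
  have : 0 < S ^+ 2 by rewrite exprn_gt0 // (le_lt_trans _ sS) // mulr_ge0.
  lra.
move=> f Df; apply: le_trans (off f Df) _.
have : s * S <= s * (4 * s) by rewrite ler_wpM2l.
by rewrite expr2; lra.
Qed.

End dyadic_chaos_bound.

(** * Counting dyadic codes *)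

Section counting.
Context {R : realType} (N L : nat).
Notation code := ({ffun 'I_N -> option (bool * 'I_L.+1)}).

Definition shallow (l : 'I_L.+1) (f : code) : bool :=
  [forall i, if f i is Some (_, k) then (k <= l)%N else true] &&
  (\sum_i (dyads f i : R) ^+ 2 <= 5).

Lemma truncate_shallow (f : code) l :
  \sum_i (dyads f i : R) ^+ 2 <= 5 -> shallow l (truncate f l).
Proof.
move=> f5; rewrite /shallow (le_trans (sum_sqr_truncate _ _) f5) andbT.
apply/forallP => i; rewrite ffunE; case: (f i) => [[s k]|] //.
by case: (leqP k l).
Qed.

Lemma sum_pow4 (l : nat) : \sum_(k < l.+1) 4 ^+ k <= 2 * 4 ^+ l :> R.
Proof.
elim: l => [|l IH]; first by rewrite big_ord1 expr0; lra.
have q0 : 0 <= 4 ^+ l :> R by rewrite exprn_ge0.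
by rewrite big_ord_recr /= exprS; lra.
Qed.

Lemma sum_pow4_linear (l : nat) : (l <= L)%N ->
  \sum_(k < l.+1) 4 ^+ k * (L.+1 - k)%:R <= 2 * (4 ^+ l * (L.+1 - l)%:R) :> R.
Proof.
elim: l => [|l IH] lL.
  rewrite big_ord1 expr0 subn0 mul1r; have : 0 <= L.+1%:R :> R by [].
  by lra.
rewrite big_ord_recr /=; have := IH (ltnW lL).
have -> : (L.+1 - l)%:R = (L.+1 - l.+1)%:R + 1 :> R.
  by rewrite natr1 -subSn // ltnS ltnW.
have : 1 <= (L.+1 - l.+1)%:R :> R by rewrite ler1n subSS subn_gt0.
set x := (_ - _)%:R; have q0 : 0 <= 4 ^+ l :> R by rewrite exprn_ge0.
move=> x1 h; have : 0 <= 4 ^+ l * (x - 1) by rewrite mulr_ge0 // subr_ge0.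
by rewrite exprS; lra.
Qed.

Lemma sum_option (T : finType) (F : option T -> R) :
  \sum_c F c = F None + \sum_x F (Some x).
Proof.
rewrite (bigD1 None) //=; congr (_ + _).
by rewrite (reindex_omap Some id) => [|[x|]] //=; apply: eq_bigl => x; rewrite eqxx.
Qed.

(* A code has weight exp(-cost), the codes of small cost being those to be
   counted; the total weight is a product over the coordinates. *)
Lemma card_shallow_le (l : 'I_L.+1) (lam : 'I_L.+1 -> R) :
  (forall k, 0 <= lam k) -> (forall k, expR (- lam k) = 4 ^+ k / N%:R) ->
  #|[set f | shallow l f]%SET|%:R <=
  expR (5 * (\sum_(k < L.+1 | (k <= l)%N) 4 ^+ k * lam k) +
        2 * \sum_(k < L.+1 | (k <= l)%N) 4 ^+ k).
Proof.
move=> lam0 lamE; set H := 5 * _; set G := (X in _ + 2 * X).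
pose wt (c : option (bool * 'I_L.+1)) : R :=
  if c is Some (_, k) then if (k <= l)%N then 4 ^+ k / N%:R else 0 else 1.
have wt0 c : 0 <= wt c by case: c => [[s k]|] //=; case: ifP.
have sumwt : \sum_c wt c = 1 + 2 * (G / N%:R).
  rewrite sum_option; congr (_ + _).
  rewrite (eq_bigr (fun x => wt (Some (x.1, x.2)))) => [|[] //].
  rewrite -(pair_bigA _ (fun s k => wt (Some (s, k)))) /= big_bool /= -big_mkcond /=.
  by rewrite -mulr_suml -/G; ring.
(* The total weight is (1 + 2 G / N)^N, the 2 counting signs, and 1 + x <= exp(x). *)
have tot : \sum_(f : code) \prod_i wt (f i) <= expR (2 * G).
  rewrite -(bigA_distr_bigA (fun=> wt)) prodr_const card_ord sumwt.
  have G0 : 0 <= G by apply: sumr_ge0 => k _; rewrite exprn_ge0.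
  have [->|N0] := posnP N; first by rewrite expr0 -expR0 ler_expR mulr_ge0.
  have -> : 2 * G = N%:R * (2 * (G / N%:R)).
    by field; rewrite pnatr_eq0 -lt0n.
  rewrite expRM_natl lerXn2r ?nnegrE ?expR_ge0 ?expR_ge1Dx //.
  by rewrite addr_ge0 // mulr_ge0 // divr_ge0.
(* A code has at most 5 4^k coordinates at level [k], each of cost [lam k]. *)
have low (f : code) : shallow l f -> expR (- H) <= \prod_i wt (f i).
  move=> /andP[/forallP fl f5].
  have -> : \prod_i wt (f i) =
      expR (- \sum_i (if f i is Some (_, k) then lam k else 0) * 1).
    rewrite -sumrN expR_sum; apply: eq_bigr => i _; rewrite mulr1.
    have := fl i; case: (f i) => [[s k]|] /=; last by rewrite oppr0 expR0.
    by move=> ->; rewrite lamE.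
  rewrite ler_expR lerN2 sum_by_level /H mulr_sumr [leRHS]big_mkcond.
  apply: ler_sum => k _; rewrite sumr_const.
  have [kl|lk] := leqP k l.
    by rewrite mulrA [leRHS]mulrC ler_wpM2l // card_level.
  suff -> : level f k = finset.set0 by rewrite cards0 mulr0n mulr0.
  apply/setP => i; rewrite !inE; have := fl i; case: (f i) => [[s k']|] // k'l.
  by apply/negbTE; apply: contraTN lk => /eqP <-; rewrite -leqNgt.
rewrite expRD -ler_pdivrMl ?expR_gt0 // -expRN mulrC.
apply: le_trans _ tot.
apply: le_trans (_ : \sum_(f in [set f | shallow l f]%SET) expR (- H) <= _).
  by rewrite sumr_const mulr_natl.
rewrite big_mkcond; apply: ler_sum => f _; rewrite inE.
by case: ifP => [/low //|_]; rewrite prodr_ge0.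
Qed.

(** The cost of level k is ln(N / 4^k), at most 3 Lam (L + 1 - k). The weighted sums are dominated
    by their last term up to a factor 2, so 34 is 5 times 3 times 2, plus 2 times 2. *)
Lemma card_shallow (l : 'I_L.+1) (Lam : R) : (4 ^ L <= N)%N ->
  1 <= Lam -> ln (N%:R / 4 ^+ L) <= 3 * Lam ->
  #|[set f | shallow l f]%SET|%:R <= expR (34 * Lam * (4 ^+ l * (L.+1 - l)%:R)).
Proof.
move=> LN Lam1 lnLam.
have N0 : 0 < N%:R :> R by rewrite ltr0n (leq_trans _ LN) // expn_gt0.
pose lam (k : 'I_L.+1) : R := ln (N%:R / 4 ^+ k).
have p0 k : 0 < N%:R / 4 ^+ k :> R by rewrite divr_gt0 // exprn_gt0.
have kN (k : 'I_L.+1) : 4 ^+ k <= N%:R :> R.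
  rewrite -natrX ler_nat (leq_trans _ LN) // leq_exp2l //; exact: leq_ord.
have lam0 k : 0 <= lam k.
  by rewrite ln_ge0 // ler_pdivlMr ?mul1r ?kN // exprn_gt0.
have lamE k : expR (- lam k) = 4 ^+ k / N%:R by rewrite expRN lnK ?posrE ?p0 // invf_div.
(* Each of the L - k steps from [k] to [L] costs ln 4 <= 2; the extra 1 in L + 1 - k absorbs ln(N /
   4^L). *)
have lamle k : lam k <= 3 * Lam * (L.+1 - k)%:R.
  have -> : lam k = ln (N%:R / 4 ^+ L) + ln 4 *+ (L - k).
    rewrite -lnXn // -lnM ?posrE ?p0 ?exprn_gt0 //; congr ln.
    rewrite -[in 4 ^+ L](subnK (leq_ord k)) exprD; field.
    by rewrite !expf_neq0 // pnatr_eq0.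
  have ln4 : ln (4 : R) <= 2.
    have -> : (4 : R) = 2 ^+ 2 by rewrite expr2; ring.
    rewrite lnXn // mulr2n; have := @le_ln1Dx R 1; rewrite (_ : 1 + 1 = 2) //.
    move=> /(_ _); have : (-1 : R) < 1 by lra. 
    by move=> h /(_ h); lra.
  have -> : (L.+1 - k)%:R = (L - k)%:R + 1 :> R by rewrite natr1 subSn // leq_ord.
  have -> : ln 4 *+ (L - k) = ln 4 * (L - k)%:R :> R by rewrite mulr_natr.
  have x0 : 0 <= (L - k)%:R :> R by [].
  have : ln 4 * (L - k)%:R <= 2 * (L - k)%:R :> R by rewrite ler_wpM2r.
  have : 1 * (L - k)%:R <= Lam * (L - k)%:R by rewrite ler_wpM2r.
  lra.
apply: le_trans (card_shallow_le l lam0 lamE) _; rewrite ler_expR.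
have wid (F : nat -> R) : \sum_(k < L.+1 | (k <= l)%N) F k = \sum_(k < l.+1) F k.
  by rewrite (big_ord_widen L.+1) // ltnS leq_ord.
rewrite (wid (fun k => 4 ^+ k)).
have h1 : \sum_(k < L.+1 | (k <= l)%N) 4 ^+ k * lam k <=
    3 * Lam * (2 * (4 ^+ l * (L.+1 - l)%:R)).
  apply: le_trans (_ : \sum_(k < L.+1 | (k <= l)%N)
    3 * Lam * (4 ^+ k * (L.+1 - k)%:R) <= _).
    by apply: ler_sum => k _; rewrite mulrCA ler_wpM2l // exprn_ge0.
  rewrite -mulr_sumr (wid (fun k => 4 ^+ k * (L.+1 - k)%:R)).
  rewrite ler_wpM2l ?sum_pow4_linear ?leq_ord //.
  by rewrite mulr_ge0 // (le_trans ler01).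
have h2 := sum_pow4 l.
have x1 : 1 <= (L.+1 - l)%:R :> R by rewrite ler1n subn_gt0.
have q0 : 0 <= 4 ^+ l :> R by rewrite exprn_ge0.
have h3 : 4 ^+ l <= 4 ^+ l * (L.+1 - l)%:R :> R by rewrite ler_peMr.
have h4 : 4 ^+ l * (L.+1 - l)%:R <= Lam * (4 ^+ l * (L.+1 - l)%:R).
  by rewrite ler_peMl // (le_trans q0).
lra.
Qed.

End counting.

(** * Independence of one column from all the others *)

Section independence.
Context {d : measure_display} {T : measurableType d} {R : realType}.
Variable P : probability T R.

(** The joint law of the pair is the product of the laws, so by Tonelli the integral over [X] may be
    taken first, with [Y] frozen. This serves as conditioning on [Y]. *)
Lemma integral_independent_le {d1 d2 : measure_display}
    {T1 : measurableType d1} {T2 : measurableType d2}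
    (X : {RV P >-> T1}) (Y : {RV P >-> T2}) (f : T1 * T2 -> \bar R)
    (g : T2 -> \bar R) :
  (forall A B, measurable A -> measurable B ->
     P (X @^-1` A `&` Y @^-1` B) = (P (X @^-1` A) * P (Y @^-1` B))%E) ->
  measurable_fun [set: T1 * T2] f -> (forall z, (0 <= f z)%E) ->
  measurable_fun [set: T2] g -> (forall y, (0 <= g y)%E) ->
  (forall y, (\int[P]_w f (X w, y) <= g y)%E) ->
  (\int[P]_w f (X w, Y w) <= \int[P]_w g (Y w))%E.
Proof.
move=> ind mf f0 mg g0 fg.
have mXY : measurable_fun [set: T] (fun w => (X w, Y w)).
  by apply: measurable_fun_pair.
pose XY : {mfun T >-> (T1 * T2)%type} := HB.pack (fun w => (X w, Y w))
  (isMeasurableFun.Build _ _ _ _ _ mXY).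
rewrite -[leLHS](@ge0_integral_distribution _ _ _ _ _ P XY f) //.
have -> : (\int[P]_w g (Y w) = \int[distribution P Y]_y g y)%E.
  by rewrite ge0_integral_distribution.
rewrite (eq_measure_integral (distribution P X \x distribution P Y)%E); last first.
  move=> A mA _; apply/esym; exact: product_measure_unique.
rewrite fubini_tonelli2 //; apply: ge0_le_integral => //.
- by move=> y _; apply: integral_ge0.
- exact: measurable_fun_fubini_tonelli_G.
- move=> y _; rewrite /fubini_G ge0_integral_distribution //.
  - exact: fg.
  - exact: measurable_fun_pair1.
Qed.

(** Rectangles, unlike cylinders over a single coordinate, are stable under intersection, as
    Dynkin's lemma demands of a generating family. *)
Lemma measurable_tuple_rectangles {d' : measure_display}
    {T' : measurableType d'} (N : nat) :
  @measurable _ (N.-tuple T') =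
  <<s [set C | exists2 B : 'I_N -> set T', (forall i, measurable (B i)) &
               C = [set y | forall i, B i (tnth y i)]] >>.
Proof.
apply/seteqP; split; apply: smallest_sub.
- exact: smallest_sigma_algebra.
- move=> C; rewrite -bigcup_seq => -[i _ [B mB <-]].
  apply: sub_sigma_algebra; exists (fun j => if j == i then B else setT).
    by move=> j; case: ifP.
  rewrite setTI; apply/seteqP; split => y /=; last by move=> /(_ i); rewrite eqxx.
  by move=> By j; case: eqP => [->|].
- exact: sigma_algebra_measurable.
- move=> _ [B mB ->].
  rewrite (_ : [set _ | _] = \bigcap_(i in [set: 'I_N]) ((@tnth N T')^~ i @^-1` B i)).
    apply: fin_bigcap_measurable => // i _; rewrite -[X in measurable X]setTI.
    exact: measurable_tnth.
  by apply/seteqP; split => y /= h i => [_|]; apply: h.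
Qed.

Section replace.
Context {d' : measure_display} {T' : measurableType d'} {N : nat}.
Variables (X : 'I_N -> {RV P >-> T'}) (i0 : 'I_N) (x0 : T').

(** The slot of [i0] holds a constant instead of being removed, so that the index type stays the
    same. *)
Definition rv_tuple_but (w : T) : N.-tuple T' :=
  [tuple if i == i0 then x0 else X i w | i < N].

Lemma measurable_rv_tuple_but : measurable_fun [set: T] rv_tuple_but.
Proof.
apply/measurable_fun_tnthP => i.
rewrite (_ : _ \o _ = if i == i0 then cst x0 else X i); last first.
  by apply/funext => w /=; rewrite tnth_mktuple; case: ifP.
by case: ifP => _; [exact: measurable_cst|].
Qed.

HB.instance Definition _ := isMeasurableFun.Build _ _ _ _ rv_tuple_but
  measurable_rv_tuple_but.

(** By Dynkin's lemma it suffices to treat rectangles. *)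
Lemma independent_rv_tuple_but A B : independent_RVs X ->
  measurable A -> measurable B ->
  P (X i0 @^-1` A `&` rv_tuple_but @^-1` B) =
  (P (X i0 @^-1` A) * P (rv_tuple_but @^-1` B))%E.
Proof.
move=> ind mA.
have mXA : measurable (X i0 @^-1` A) by exact: measurable_funPTI.
pose Q (C : set (N.-tuple T')) := P (X i0 @^-1` A `&` rv_tuple_but @^-1` C) =
  (P (X i0 @^-1` A) * P (rv_tuple_but @^-1` C))%E.
have mY C : measurable C -> measurable (rv_tuple_but @^-1` C).
  by move=> mC; rewrite -[X in measurable X]setTI; exact: measurable_rv_tuple_but.
move=> mB; rewrite -/(Q B); move: B mB; rewrite measurable_tuple_rectangles.
apply: dynkin_induction.
- exact: measurable_tuple_rectangles.
- move=> _ _ [B mB ->] [C mC ->]; exists (fun i => B i `&` C i).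
    by move=> i; exact: measurableI.
  apply/seteqP; split => y /= => [[h1 h2] i|h]; first by split.
  by split=> i; case: (h i).
- by rewrite /Q preimage_setT setIT probability_setT mule1.
- move=> _ [B mB ->]; rewrite /Q.
  (* If the constant misses its side of the rectangle, both probabilities are 0. *)
  have [Bx0|Bx0] := pselect (B i0 x0); last first.
    rewrite (_ : rv_tuple_but @^-1` _ = set0) ?setI0 ?measure0 ?mule0 //.
    apply/seteqP; split => // w /= /(_ i0).
    by rewrite tnth_mktuple eqxx.
  pose B' i := if i == i0 then A else B i.
  have mB' i : measurable (B' i) by rewrite /B'; case: ifP.
  (* Independence is used for all indices and for all but [i0]; the two products differ by the
     factor of [i0]. *)
  have I1 := ind [set: 'I_N]%SET B' mB'; have I2 := ind [set~ i0]%SET B' mB'.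
  rewrite (bigD1 i0) ?inE //= {2}/B' eqxx in I1.
  rewrite (eq_bigl (fun i => i \in [set~ i0]%SET)) in I1; last first.
    by move=> i; rewrite !inE.
  rewrite -I2 in I1; move: I1.
  rewrite (_ : [set w | forall i, i \in [set~ i0]%SET -> B' i (X i w)] =
      rv_tuple_but @^-1` [set y | forall i, B i (tnth y i)]); last first.
    apply/seteqP; split => w /= h i.
      rewrite tnth_mktuple; have [->//|ii0] := eqVneq i i0.
      by have := h i; rewrite !inE ii0 /B' (negbTE ii0) => /(_ isT).
    rewrite !inE => ii0; have := h i; rewrite tnth_mktuple (negbTE ii0) /B'.
    by rewrite (negbTE ii0).
  move=> <-; congr (P _); apply/seteqP; split => w /=.
    move=> [h1 h i] _; rewrite /B'; have [->//|ii0] := eqVneq i i0.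
    by have := h i; rewrite tnth_mktuple (negbTE ii0).
  move=> h; split; first by have := h i0 (finset.in_setT _); rewrite /B' eqxx.
  move=> i; rewrite tnth_mktuple; have [->//|ii0] := eqVneq i i0.
  by have := h i (finset.in_setT _); rewrite /B' (negbTE ii0).
- move=> C mC QC; rewrite /Q -preimage_setC.
  have mXC : measurable (X i0 @^-1` A `&` rv_tuple_but @^-1` C).
    by apply: measurableI => //; exact: mY.
  have -> : P (X i0 @^-1` A `&` ~` (rv_tuple_but @^-1` C)) =
      (P (X i0 @^-1` A) - P (X i0 @^-1` A `&` rv_tuple_but @^-1` C))%E.
    rewrite -setDE measureD ?setIid //; first exact: mY.
    by rewrite -ge0_fin_numE ?fin_num_measure.
  rewrite QC probability_setC; last exact: mY.
  by rewrite muleBr ?mule1 // ?fin_num_adde_defl ?fin_num_measure //; exact: mY.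
- move=> F mF tF QF; rewrite /Q preimage_bigcup setI_bigcupr.
  have tF' : trivIset [set: nat] (fun k => rv_tuple_but @^-1` F k).
    apply/trivIsetP => i j _ _ ij; rewrite -preimage_setI.
    by move/trivIsetP : tF => /(_ _ _ _ _ ij) -> //; rewrite preimage_set0.
  rewrite !measure_bigcup //; last 3 first.
  + by move=> k _; exact: mY.
  + by move=> k _; apply: measurableI => //; exact: mY.
  + by apply: trivIset_setIl.
  have [a aE] : exists a : R, P (X i0 @^-1` A) = a%:E.
    by exists (fine (P (X i0 @^-1` A))); rewrite fineK // fin_num_measure.
  rewrite aE -nneseriesZl //; apply: eq_eseriesr => k _.
  by rewrite -aE; exact: QF.
Qed.

End replace.

End independence.

(** * Measurability of inner products, norms and pasts *)

Section measurability.
Context {d : measure_display} {T : measurableType d} {R : realType}.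

Definition measurable_vector {n : nat} (u : T -> 'cV[R]_n) :=
  forall k, measurable_fun [set: T] (fun w => u w k 0).

Lemma measurable_dotp n (u v : T -> 'cV[R]_n) :
  measurable_vector u -> measurable_vector v ->
  measurable_fun [set: T] (fun w => dotp (u w) (v w)).
Proof. by move=> mu mv; apply: measurable_sum => k; exact: measurable_funM. Qed.

Lemma measurable_enorm n (u : T -> 'cV[R]_n) :
  measurable_vector u -> measurable_fun [set: T] (fun w => enorm (u w)).
Proof.
move=> mu; apply: measurableT_comp; last exact: measurable_dotp.
apply: continuous_measurable_fun; exact: sqrt_continuous.
Qed.

Lemma measurable_past n N L (X : T -> 'I_N -> 'cV[R]_n)
    (f : {ffun 'I_N -> option (bool * 'I_L.+1)}) j :
  (forall i, measurable_vector (fun w => X w i)) ->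
  measurable_vector (fun w => past (X w) f j).
Proof.
move=> mX k; rewrite /past.
under eq_fun do rewrite summxE big_mkcond.
apply: measurable_sum => i; case: (precedes f i j); last exact: measurable_cst.
under eq_fun do rewrite mxE.
by apply: measurable_funM; [exact: measurable_cst|exact: mX].
Qed.

(** The summand of [tamed], as a function of a column [x] and its past [v]. *)
Definition ratio {n : nat} (psi r : R) (x v : 'cV[R]_n) : R :=
  (`|dotp x v| / (psi * enorm v)) `^ r.

Lemma measurable_ratio n psi r (u v : T -> 'cV[R]_n) : 0 <= psi ->
  measurable_vector u -> measurable_vector v ->
  measurable_fun [set: T] (fun w => ratio psi r (u w) (v w)).
Proof.
move=> psi0 mu mv.
apply: (measurableT_comp (measurable_powR r)).
(* Division becomes the power -1 of a nonnegative number, which agrees with the inverse at 0 too. *)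
rewrite (_ : (fun w => _) =
    fun w => `|dotp (u w) (v w)| * (psi * enorm (v w)) `^ (-1)); last first.
  by apply/funext => w; rewrite powR_inv1 // mulr_ge0 // enorm_ge0.
apply: measurable_funM.
  by apply: measurableT_comp => //; exact: measurable_dotp.
apply: (measurableT_comp (measurable_powR (-1))).
by apply: measurable_funM; [exact: measurable_cst|exact: measurable_enorm].
Qed.

Lemma measurable_vec n (X : T -> n.-tuple R) :
  measurable_fun [set: T] X -> measurable_vector (fun w => vec (X w)).
Proof.
move=> mX k; rewrite (_ : (fun w => _) = (@tnth n R ^~ k) \o X).
  exact: measurableT_comp (measurable_tnth k) mX.
by apply/funext => w; rewrite /= mxE.
Qed.

End measurability.

(** * Exponential moments along a level *)

Section exponential_moments.
Context {d : measure_display} {T : measurableType d} {R : realType}.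
Variable P : probability T R.

(** The doubled scale leaves room for an admissible constant below [2 * psi], so the infimum need
    not be known to be attained. *)
Lemma psi_norm_expR (r psi : R) (Y : T -> R) : 0 <= r -> 0 < psi ->
  measurable_fun [set: T] Y -> (psi_norm P r Y <= psi%:E)%E ->
  (\int[P]_w (expR ((`|Y w| / (2 * psi)) `^ r))%:E <= 2%:E)%E.
Proof.
move=> r0 psi0 mY Yp.
have : (psi_norm P r Y < (2 * psi)%:E)%E.
  by rewrite (le_lt_trans Yp) // lte_fin; lra.
move=> /ereal_inf_lt [_ [C [C0 EC] <-]]; rewrite lte_fin => Cpsi.
have mE c : 0 < c -> measurable_fun [set: T] (fun w => (expR ((`|Y w| / c) `^ r))%:E).
  move=> c0; apply/measurable_EFinP; apply: (measurableT_comp (@measurable_expR R)).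
  apply: (measurableT_comp (measurable_powR r)).
  by apply: measurable_funM => //; exact: measurableT_comp.
apply: le_trans EC; rewrite unlock; apply: ge0_le_integral.
- by [].
- by move=> w _; rewrite lee_fin expR_ge0.
- by apply: mE; lra.
- exact: mE.
- move=> w _; rewrite lee_fin ler_expR ge0_ler_powR // ?nnegrE ?divr_ge0 ?(ltW C0) //.
    by lra.
  by rewrite ler_wpM2l // lef_pV2 ?posrE ?(ltW Cpsi) // (lt_trans C0).
Qed.

Lemma ratio_expR n (r psi : R) (X : {RV P >-> n.-tuple R}) (v : 'cV[R]_n) :
  0 < r -> 0 < psi ->
  (forall y, usphere y ->
     (psi_norm P r (fun w => dotp (vec (X w)) y) <= psi%:E)%E) ->
  (\int[P]_w (expR (ratio (2 * psi) r (vec (X w)) v))%:E <= 2%:E)%E.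
Proof.
move=> r0 psi0 Xpsi; have [v0|v0] := eqVneq (enorm v) 0.
  (* For [v] = 0 the ratio is 0 by the convention 0 / 0 = 0, and the integrand is 1. *)
  rewrite (eq_integral (cst 1%:E)); last first.
    move=> w _; rewrite /ratio (enorm0_eq0 v0) dotp0r normr0 mul0r.
    by rewrite powR0 ?expR0 // gt_eqF.
  rewrite integral_cst // mul1e (le_trans (probability_le1 P measurableT)) //.
  by rewrite lee_fin; lra.
have vp : 0 < enorm v by rewrite lt_neqAle eq_sym v0 enorm_ge0.
pose u := (enorm v)^-1 *: v.
have us : usphere u.
  apply/eqP; rewrite -(eqrXn2 (n := 2)) ?enorm_ge0 // sqr_enorm dotpZl dotpZr.
  by rewrite -sqr_enorm; apply/eqP; field.
have mXu : measurable_fun [set: T] (fun w => dotp (vec (X w)) u).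
  apply: measurable_dotp; first exact: measurable_vec.
  by move=> k; exact: measurable_cst.
apply: le_trans (psi_norm_expR (ltW r0) psi0 mXu (Xpsi u us)).
rewrite le_eqVlt; apply/orP; left; apply/eqP; apply: eq_integral => w _.
have -> : ratio (2 * psi) r (vec (X w)) v = (`|dotp (vec (X w)) u| / (2 * psi)) `^ r.
  rewrite /ratio dotpZr normrM (ger0_norm (_ : 0 <= (enorm v)^-1)).
    by congr (_ `^ _); field; rewrite v0 gt_eqF.
  by rewrite invr_ge0 ltW.
by [].
Qed.

Context {n N L : nat} (X : 'I_N -> {RV P >-> n.-tuple R}).
Variables (r psi : R) (f : {ffun 'I_N -> option (bool * 'I_L.+1)}).
Hypotheses (r0 : 0 < r) (psi0 : 0 < psi) (ind : independent_RVs X).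
Hypothesis Xpsi : forall i y, usphere y ->
  (psi_norm P r (fun w => dotp (vec (X i w)) y) <= psi%:E)%E.

Let cols (y : N.-tuple (n.-tuple R)) (i : 'I_N) : 'cV[R]_n := vec (tnth y i).

Let factor (Z : 'I_N -> 'cV[R]_n) (j : 'I_N) : R :=
  expR (ratio (2 * psi) r (Z j) (past Z f j)).

(* Conditioning on all columns but the last one in [J] costs a factor 2. *)
Lemma integral_level_expR (l : 'I_L.+1) (J : {set 'I_N}) :
  J \subset level f l ->
  (\int[P]_w (\prod_(j in J) factor (fun i => vec (X i w)) j)%:E <= (2 ^+ #|J|)%:E)%E.
Proof.
move: {2}#|J| (erefl #|J|) => k.
elim: k J => [|k IH] J.
  move/eqP; rewrite cards_eq0 => /eqP -> _; rewrite cards0.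
  rewrite (eq_integral (cst 1%:E)); last by move=> w _; rewrite big_set0.
  by rewrite integral_cst // mul1e probability_le1.
move=> Jk Jl.
have [j1 j1J] : exists j, j \in J by apply/card_gt0P; rewrite Jk.
(* Inside a level the order is by index, so the largest index comes last and occurs in no past of a
   member of [J]. *)
pose j0 := [arg max_(j > j1 | j \in J) (j : nat)].
have [j0J j0max] : j0 \in J /\ forall j, j \in J -> (j <= j0)%N.
  by rewrite /j0; case: arg_maxnP.
pose J' := J :\ j0.
have J'k : #|J'| = k by move: Jk; rewrite (cardsD1 j0) j0J => -[].
have J'l : J' \subset level f l by apply: fintype.subset_trans Jl; exact: finset.subsetDl.
have notpast i j : j \in J -> precedes f i j -> i != j0.
  move=> jJ; apply: contraTneq => ->.
  have := fintype.subsetP Jl _ jJ; have := fintype.subsetP Jl _ j0J.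
  rewrite !inE /precedes; case: (f j0) => [[s0 k0]|] // /eqP ->.
  case: (f j) => [[s1 k1]|] // /eqP ->.
  by rewrite ltnn eqxx /= -leqNgt j0max.
(* Filling the slot of the last column with 0 makes [Y] independent of that column and leaves the
   pasts unchanged. *)
pose x0 : n.-tuple R := [tuple 0 | _ < n].
pose Y := rv_tuple_but X j0 x0.
have pastY w j : j \in J ->
    past (cols (Y w)) f j = past (fun i => vec (X i w)) f j.
  move=> jJ; apply: eq_bigr => i ij; congr (_ *: _).
  by rewrite /cols tnth_mktuple (negbTE (notpast i j jJ ij)).
have colsY w j : j != j0 -> cols (Y w) j = vec (X j w).
  by move=> jj0; rewrite /cols tnth_mktuple (negbTE jj0).
pose g (y : N.-tuple (n.-tuple R)) : R := \prod_(j in J') factor (cols y) j.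
pose h (z : n.-tuple R * N.-tuple (n.-tuple R)) : R :=
  g z.2 * expR (ratio (2 * psi) r (vec z.1) (past (cols z.2) f j0)).
have psi20 : 0 <= 2 * psi by rewrite mulr_ge0 // ltW.
have mcols i : measurable_vector (fun y => cols y i).
  by apply: measurable_vec; exact: measurable_tnth.
have mg : measurable_fun [set: N.-tuple (n.-tuple R)] g.
  rewrite (_ : g = fun y => \prod_(j <- enum J') factor (cols y) j); last first.
    by apply/funext => y; rewrite /g big_enum.
  apply: measurable_prod => j _.
  apply: (measurableT_comp (@measurable_expR R)).
  by apply: measurable_ratio => //; exact: measurable_past.
have g0 y : 0 <= g y by apply: prodr_ge0 => j _; exact: expR_ge0.
have mh : measurable_fun [set: n.-tuple R * N.-tuple (n.-tuple R)] h.
  apply: measurable_funM; first exact: measurableT_comp.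
  apply: (measurableT_comp (@measurable_expR R)).
  apply: measurable_ratio => //; first exact: measurable_vec.
  by apply: measurable_past => i k'; apply: (measurableT_comp (mcols i k')).
have gY w : g (Y w) = \prod_(j in J') factor (fun i => vec (X i w)) j.
  apply: eq_bigr => j; rewrite 2!inE => /andP[jj0 jJ].
  by rewrite /factor (pastY _ _ jJ) (colsY _ _ jj0).
have hXY w : \prod_(j in J) factor (fun i => vec (X i w)) j = h (X j0 w, Y w).
  by rewrite (big_setD1 j0 j0J) /= mulrC /h /= gY (pastY _ _ j0J).
have mY : measurable_fun [set: T] Y by exact: measurable_rv_tuple_but.
pose Yrv : {RV P >-> N.-tuple (n.-tuple R)} := HB.pack Y
  (isMeasurableFun.Build _ _ _ _ _ mY).
under eq_integral do rewrite hXY.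
(* With the other columns frozen, the factor of the last one has mean at most 2. *)
apply: (@le_trans _ _ (\int[P]_w (2%:E * (g (Yrv w))%:E))%E).
  apply: (@integral_independent_le _ _ _ P _ _ _ _ (X j0) Yrv
    (EFin \o h) (fun y => 2%:E * (g y)%:E)%E) => //.
  - by move=> A B mA mB; exact: independent_rv_tuple_but.
  - exact/measurable_EFinP.
  - by move=> z; rewrite lee_fin mulr_ge0 ?expR_ge0.
  - rewrite (_ : (fun y => _) = EFin \o (fun y => 2 * g y)) //.
    apply/measurable_EFinP; apply: measurable_funM; last exact: mg.
    exact: measurable_cst.
  - by move=> y; rewrite mule_ge0 // lee_fin.
  - move=> y; rewrite /h /=.
    under eq_integral do rewrite EFinM.
    rewrite ge0_integralZl //; last 2 first.
    + apply/measurable_EFinP; apply: (measurableT_comp (@measurable_expR R)).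
      by apply: measurable_ratio => //; exact: measurable_vec.
    + by rewrite lee_fin.
    rewrite muleC; apply: lee_wpmul2r; first by rewrite lee_fin.
    exact: ratio_expR r0 psi0 (Xpsi j0).
rewrite ge0_integralZl //; last 2 first.
- by apply/measurable_EFinP; exact: (measurableT_comp mg mY).
- by move=> w _; rewrite lee_fin.
rewrite Jk exprS EFinM lee_wpmul2l // -J'k.
apply: le_trans (IH J' J'k J'l); rewrite le_eqVlt; apply/orP; left; apply/eqP.
by apply: eq_integral => w _; rewrite -gY.
Qed.

Let level_sum (l : 'I_L.+1) (w : T) : R := \sum_(j in level f l)
  ratio (2 * psi) r (vec (X j w)) (past (fun i => vec (X i w)) f j).

Let measurable_level_sum l : measurable_fun [set: T] (level_sum l).
Proof.
rewrite /level_sum; under eq_fun do rewrite big_mkcond.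
apply: measurable_sum => j; case: (j \in _); last exact: measurable_cst.
apply: measurable_ratio; first by rewrite mulr_ge0 // ltW.
  exact: measurable_vec.
by apply: measurable_past => i; exact: measurable_vec.
Qed.

Lemma measurable_tamed (l : 'I_L.+1) (tau : R) :
  measurable [set w | tamed (fun i => vec (X i w)) (2 * psi) r tau f l].
Proof.
rewrite (_ : [set _ | _] = level_sum l @^-1` [set` `]-oo, tau]]); last first.
  by apply/seteqP; split => w /=; rewrite in_itv.
by rewrite -[X in measurable X]setTI; exact: measurable_level_sum.
Qed.

(** Markov's inequality for the exponential of the level sum. *)
Lemma prob_not_tamed (l : 'I_L.+1) (tau : R) :
  (P (~` [set w | tamed (fun i => vec (X i w)) (2 * psi) r tau f l]) <=
   (2 ^+ #|level f l| * expR (- tau))%:E)%E.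
Proof.
pose S : {RV P >-> R} := HB.pack (level_sum l)
  (isMeasurableFun.Build _ _ _ _ _ (@measurable_level_sum l)).
apply: (@le_trans _ _ (P [set w | S w >= tau])).
  apply: le_measure; rewrite ?inE.
  - exact/measurableC/measurable_tamed.
  - rewrite (_ : [set _ | _] = S @^-1` [set` `[tau, +oo[]).
      exact: measurable_funPTI.
    by apply/seteqP; split => w /=; rewrite in_itv /= andbT.
  - by move=> w /= /negP; rewrite -ltNge => /ltW.
apply: le_trans (chernoff S tau ltr01) _.
rewrite mul1r EFinM; apply: lee_wpmul2r; first by rewrite lee_fin expR_ge0.
apply: le_trans (integral_level_expR (subxx (level f l))).
rewrite /mmt_gen_fun unlock le_eqVlt; apply/orP; left; apply/eqP.
apply: eq_integral => w _; rewrite /= mulr1 -expR_sum.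
by [].
Qed.

End exponential_moments.

(** * The union bound *)

Section bad_event.
Context {d : measure_display} {T : measurableType d} {R : realType}.
Variable P : probability T R.

Lemma prob_bigsetU_le (I : Type) (s : seq I) (A : I -> set T) :
  (forall i, measurable (A i)) ->
  (P (\big[setU/set0]_(i <- s) A i) <= \sum_(i <- s) P (A i))%E.
Proof.
move=> mA; elim: s => [|i s IH]; first by rewrite !big_nil measure0.
rewrite !big_cons; apply: (@le_trans _ _ (P (A i) + P (\big[setU/set0]_(j <- s) A j))%E).
  by apply: measureU2 => //; exact: bigsetU_measurable.
exact: leeD2l.
Qed.

(** Put x = 4^l (L + 1 - l). There are at most exp(34 Lam x) codes, each with a moment factor at
    most exp(5 4^l), against the budget 40 Lam x + 2^L Lam. Since 4^l <= Lam x, a factor exp(- 4^l)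
    <= 2^-l remains and makes the sum over levels converge. *)
Lemma sum_tail_le (N L : nat) (Lam : R) : (4 ^ L <= N)%N -> 1 <= Lam ->
  ln (N%:R / 4 ^+ L) <= 3 * Lam ->
  \sum_(l < L.+1) \sum_(f : {ffun 'I_N -> option (bool * 'I_L.+1)} | shallow (R := R) l f)
    2 ^+ #|level f l| * expR (- (budget L l * Lam)) <= 2 * expR (- (2 ^+ L * Lam)) :> R.
Proof.
move=> LN Lam1 lnLam.
have e2 : 2 <= expR 1 :> R by have := expR_ge1Dx (1 : R); lra.
have term (l : 'I_L.+1) :
    \sum_(f : {ffun 'I_N -> option (bool * 'I_L.+1)} | shallow (R := R) l f)
      2 ^+ #|level f l| * expR (- (budget L l * Lam)) <=
    2^-1 ^+ l * expR (- (2 ^+ L * Lam)) :> R.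
  have q0 : 0 <= 4 ^+ l :> R by rewrite exprn_ge0.
  pose x : R := 4 ^+ l * (L.+1 - l)%:R.
  have x1 : 4 ^+ l <= x.
    by rewrite ler_peMr // ler1n subn_gt0.
  have x2 : x <= Lam * x by rewrite ler_peMl // (le_trans q0).
  apply: le_trans (_ : \sum_(f | shallow (R := R) l f)
      expR (5 * 4 ^+ l - budget L l * Lam) <= _).
    apply: ler_sum => f /andP[_ f5]; rewrite expRD ler_wpM2r ?expR_ge0 //.
    apply: le_trans (_ : expR (#|level f l|%:R * 1) <= _).
      by rewrite expRM_natl lerXn2r ?nnegrE ?expR_ge0.
    by rewrite ler_expR mulr1 card_level.
  have cs := card_shallow l LN Lam1 lnLam; rewrite cardsE in cs.
  rewrite sumr_const -[leLHS]mulr_natl; apply: le_trans (ler_wpM2r (expR_ge0 _) cs) _.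
  rewrite -expRD -/x.
  apply: le_trans (_ : expR (- 4 ^+ l + - (2 ^+ L * Lam)) <= _).
    have -> : budget L l * Lam = 40 * (Lam * x) + 2 ^+ L * Lam.
      by rewrite /budget /x; ring.
    by rewrite ler_expR; lra.
  rewrite expRD ler_wpM2r ?expR_ge0 // expRN exprVn lef_pV2 ?posrE ?expR_gt0 ?exprn_gt0 //.
  apply: le_trans (expR_ge1Dx _).
  have : 2 ^+ l <= 4 ^+ l :> R by rewrite lerXn2r // ?nnegrE //; lra.
  lra.
apply: le_trans (ler_sum _ (fun l _ => term l)) _.
by rewrite -mulr_suml ler_wpM2r ?expR_ge0 // sum_pow2V.
Qed.

(** The union runs over pairs of a level and a code shallow at it; any other code of square sum at
    most 5 is tamed there because its truncation is. *)
Lemma tamed_event (n N L : nat) (X : 'I_N -> {RV P >-> n.-tuple R})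
    (r psi Lam : R) :
  0 < r -> 0 < psi -> independent_RVs X ->
  (forall i y, usphere y ->
     (psi_norm P r (fun w => dotp (vec (X i w)) y) <= psi%:E)%E) ->
  (4 ^ L <= N)%N -> 1 <= Lam -> ln (N%:R / 4 ^+ L) <= 3 * Lam ->
  exists B : set T, [/\ measurable B,
    (P B <= (2 * expR (- (2 ^+ L * Lam)))%:E)%E &
    forall w, ~ B w -> forall (f : {ffun 'I_N -> option (bool * 'I_L.+1)})
      (l : 'I_L.+1), \sum_i (dyads f i : R) ^+ 2 <= 5 ->
      tamed (fun i => vec (X i w)) (2 * psi) r (budget L l * Lam) f l].
Proof.
move=> r0 psi0 ind Xpsi LN Lam1 lnLam.
pose A (q : 'I_L.+1 * {ffun 'I_N -> option (bool * 'I_L.+1)}) : set T :=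
  if shallow (R := R) q.1 q.2 then
    ~` [set w | tamed (fun i => vec (X i w)) (2 * psi) r (budget L q.1 * Lam) q.2 q.1]
  else set0.
have mA q : measurable (A q).
  by rewrite /A; case: ifP => // _; apply: measurableC; exact: measurable_tamed.
exists (\big[setU/set0]_q A q); split.
- exact: bigsetU_measurable.
- apply: le_trans (prob_bigsetU_le _ mA) _.
  apply: le_trans (_ : (\sum_q (if shallow (R := R) q.1 q.2 then
    2 ^+ #|level q.2 q.1| * expR (- (budget L q.1 * Lam)) else 0)%:E <= _)%E).
    apply: lee_sum => q _; rewrite /A; case: ifP => _; last by rewrite measure0.
    exact: prob_not_tamed.
  rewrite sumEFin lee_fin; apply: le_trans (sum_tail_le LN Lam1 lnLam).
  rewrite -(pair_bigA _ (fun (l : 'I_L.+1) f => if shallow (R := R) l f then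
    2 ^+ #|level f l| * expR (- (budget L l * Lam)) else 0)) /=.
  by apply: ler_sum => l _; rewrite -big_mkcond.
- move=> w Bw f l f5; apply: tamed_truncate; apply: contrapT => ntam.
  apply: Bw; rewrite -bigcup_seq; exists (l, truncate f l) => /=.
    by rewrite mem_index_enum.
  by rewrite /A /= truncate_shallow.
Qed.

End bad_event.

(** * The null space property from tamed levels *)

Section deterministic_conclusion.
Context {R : realType}.

Lemma null_space_of_tamed (n N L m : nat) (A : 'M[R]_(n, N)) (psi r Lam : R) :
  0 < psi -> 1 <= r -> 0 < Lam -> (0 < n)%N ->
  (forall j, 3 / 4 * n%:R <= dotp (col j A) (col j A) <= 5 / 4 * n%:R) ->
  (forall (f : {ffun 'I_N -> option (bool * 'I_L.+1)}) (l : 'I_L.+1),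
     \sum_i (dyads f i : R) ^+ 2 <= 5 ->
     tamed (fun j => col j A) psi r (budget L l * Lam) f l) ->
  344 * (psi * Lam `^ r^-1 * 2 ^+ L) <= Num.sqrt n%:R / 16 ->
  (0 < m)%N -> (15 * m <= 4 ^ L)%N -> null_space_property m A.
Proof.
move=> psi0 r1 Lam0 n0 Adiag tam small m0 mL.
have nR : 0 < n%:R :> R by rewrite ltr0n.
have s2 : Num.sqrt n%:R ^+ 2 = n%:R :> R by rewrite sqr_sqrtr // ltW.
have Xs j : dotp (col j A) (col j A) <= 5 / 4 * Num.sqrt n%:R ^+ 2.
  by rewrite s2; case/andP: (Adiag j).
have off := off_diag_tamed_small psi0 r1 Lam0 (sqrtr_ge0 _) Xs tam small.
rewrite s2 in off.
have {}off (f : {ffun 'I_N -> option (bool * 'I_L.+1)}) :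
    \sum_i (dyads f i : R) ^+ 2 <= 5 ->
    - (n%:R / 4) <= off_diag (fun j => col j A) (dyads f).
  move=> f5; have : `|off_diag (fun j => col j A) (dyads f)| <= n%:R / 4.
    exact: off.
  by rewrite ler_norml => /andP[].
(* The diagonal contributes at least 3/4 n and the off-diagonal part at least - n/4, which leaves a
   = n/2. *)
apply: (@null_space_of_sparse _ n N m (4 ^ L) A (n%:R / 2) (5 / 4 * n%:R)).
- by rewrite expn_gt0.
- by apply/andP; split; lra.
- by move=> j; case/andP: (Adiag j).
- move=> z zL; rewrite dotp_lin.
  have := off_diag_dyadic off zL.
  set q := \sum_i z i ^+ 2 => h.
  have : 3 / 4 * n%:R * q <= \sum_i z i ^+ 2 * dotp (col i A) (col i A).
    rewrite /q mulr_sumr; apply: ler_sum => i _; rewrite mulrC ler_wpM2l ?sqr_ge0 //.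
    by case/andP: (Adiag i).
  lra.
(* The claim amounts to 27/2 m <= M - 1, and 15 m - 1 >= 14 m because m >= 1. *)
- have : 15 * m%:R <= (4 ^ L)%:R :> R by rewrite -natrM ler_nat.
  have : 1 <= m%:R :> R by rewrite ler1n.
  set M := (4 ^ L)%:R; set k := m%:R => k1 Mk.
  have : 0 <= n%:R * (M - 15 * k) by rewrite mulr_ge0 ?subr_ge0 // ltW.
  have : 0 <= n%:R * (k - 1) by rewrite mulr_ge0 ?subr_ge0 // ltW.
  nra.
Qed.

Lemma exists_pow2 (x : R) : 1 <= x -> exists L : nat, 2 ^+ L <= x < 2 ^+ L.+1.
Proof.
move=> x1; have := @upper_nthrootP R x _ (leqnn _).
elim: (Num.bound x) => [|k IH]; first by rewrite expr0 ltNge x1.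
by have [xk _|xk h] := ltP x (2 ^+ k); [exact: IH|exists k; rewrite xk h].
Qed.

End deterministic_conclusion.

(** * Choice of the depth [L] *)

Section parameters.
Context {R : realType}.

Lemma ln_ge1 (x : R) : 4 <= x -> 1 <= ln x.
Proof.
move=> x4; apply: (@le_trans _ _ (ln 4)); last first.
  by rewrite ler_ln ?posrE //; lra.
have -> : (4 : R) = 2 ^+ 2 by rewrite expr2; ring.
rewrite lnXn // mulr2n.
(* The inequality ln(1 + x) <= x at x = -1/2 gives ln 2 >= 1/2. *)
have : ln (1 + - 2^-1 : R) <= - 2^-1 by apply: le_ln1Dx; lra.
have -> : 1 + - 2^-1 = 2^-1 :> R by field.
by rewrite lnV ?posrE //; lra.
Qed.

(* [L] is the largest integer with 2^L Lam^(1/r) <= c1 sqrt(n) / psi^2. *)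
Lemma choose_depth (c1 : R) (m n N : nat) (r psi Lam : R) :
  0 < c1 <= 1 -> (0 < m)%N -> (0 < n)%N -> (n <= N)%N -> 1 <= r -> 1 <= psi ->
  Lam = ln (4 / c1 ^+ 2 * psi ^+ 6 * N%:R / n%:R) ->
  m%:R <= c1 ^+ 2 / 60 * n%:R / (psi ^+ 4 * Lam `^ (2 / r)) ->
  exists L : nat,
    [/\ 1 <= Lam, (15 * m <= 4 ^ L)%N /\ (4 ^ L <= N)%N,
        ln (N%:R / 4 ^+ L) <= 3 * Lam,
        Lam `^ r^-1 * 2 ^+ L <= c1 * (Num.sqrt n%:R / psi ^+ 2) &
        c1 * (Num.sqrt n%:R / psi ^+ 2) <= 2 * (2 ^+ L * Lam)].
Proof.
move=> /andP[c0 c1le] m0 n0 nN r1 psi1 LamE mle.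
have nR : 0 < n%:R :> R by rewrite ltr0n.
have N0 : 0 < N%:R :> R by rewrite ltr0n (leq_trans n0).
have psi0 : 0 < psi by rewrite (lt_le_trans ltr01).
have m1 : 1 <= m%:R :> R by rewrite ler1n.
have c2 : 0 < c1 ^+ 2 by rewrite exprn_gt0.
have c21 : c1 ^+ 2 <= 1 by rewrite expr_le1 // ltW.
pose y : R := psi ^+ 6 * N%:R / n%:R.
have y1 : 1 <= y.
  rewrite /y -mulrA; apply: mulr_ege1; first by rewrite exprn_ege1.
  by rewrite ler_pdivlMr // mul1r ler_nat.
have y0 : 0 < y by rewrite (lt_le_trans ltr01).
have Cy : 4 / c1 ^+ 2 * psi ^+ 6 * N%:R / n%:R = 4 / c1 ^+ 2 * y by rewrite /y; ring.
have C4 : 4 <= 4 / c1 ^+ 2 by rewrite ler_pdivlMr //; lra.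
have C0 : 0 < 4 / c1 ^+ 2 by rewrite (lt_le_trans _ C4).
have Lam1 : 1 <= Lam.
  by rewrite LamE Cy ln_ge1 // (le_trans C4) // ler_peMr // ltW.
have Lam0 : 0 < Lam by rewrite (lt_le_trans ltr01).
set v := Lam `^ r^-1.
have r0 : 0 < r by rewrite (lt_le_trans ltr01).
have v1 : 1 <= v.
  by rewrite -(powRr0 Lam) /v ler_powR // invr_ge0 ltW.
have v0 : 0 < v by rewrite (lt_le_trans ltr01).
have vLam : v <= Lam.
  by rewrite -[leRHS](powRr1 (ltW Lam0)) ler_powR // invf_le1.
have v2 : Lam `^ (2 / r) = v ^+ 2.
  by rewrite /v -powR_mulrn ?powR_ge0 // -powRrM mulrC.
have [a aE] : exists a : R, a = Num.sqrt n%:R / psi ^+ 2.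
  by exists (Num.sqrt n%:R / psi ^+ 2).
rewrite -aE.
have a0 : 0 < a by rewrite aE divr_gt0 ?sqrtr_gt0 ?exprn_gt0.
have a2 : a ^+ 2 = n%:R / psi ^+ 4.
  by rewrite aE expr_div_n sqr_sqrtr ?(ltW nR) // -exprM.
(* This is the assumption on [m], with a = sqrt(n) / psi^2 and v = Lam^(1/r). *)
have mv : 60 * (m%:R * v ^+ 2) <= c1 ^+ 2 * a ^+ 2.
  rewrite -ler_pdivlMl // -ler_pdivlMr ?exprn_gt0 //; apply: le_trans mle _.
  rewrite v2 a2 le_eqVlt; apply/orP; left; apply/eqP; field.
  by rewrite !gt_eqF.
have x1 : 1 <= c1 * a / v.
  rewrite ler_pdivlMr // mul1r -(ler_pXn2r (n := 2)) ?nnegrE ?(ltW v0) //; last first.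
    by rewrite mulr_ge0 // ltW.
  have : 1 * v ^+ 2 <= m%:R * v ^+ 2 by rewrite ler_wpM2r // sqr_ge0.
  have : 0 <= c1 ^+ 2 * a ^+ 2 by rewrite mulr_ge0 ?sqr_ge0.
  by rewrite exprMn; lra.
have [L /andP[L1 L2]] := exists_pow2 x1.
rewrite ler_pdivlMr // in L1; rewrite ltr_pdivrMr // in L2.
have four k : (2 ^+ k) ^+ 2 = 4 ^+ k :> R.
  by rewrite -exprM mulnC exprM; congr (_ ^+ _); rewrite expr2; ring.
have p1 : 0 <= 2 ^+ L * v by rewrite mulr_ge0 ?exprn_ge0 // ltW.
have p2 : 0 <= c1 * a by rewrite mulr_ge0 // ltW.
have L1s : 4 ^+ L * v ^+ 2 <= c1 ^+ 2 * a ^+ 2.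
  by rewrite -four -!exprMn lerXn2r.
have L2s : c1 ^+ 2 * a ^+ 2 < 4 * 4 ^+ L * v ^+ 2.
  by rewrite -exprS -four -!exprMn ltrXn2r ?nnegrE.
have q0 : 0 < 4 ^+ L :> R by rewrite exprn_gt0.
exists L; split => //.
(* Maximality of [L] gives 60 m v^2 <= c1^2 a^2 < 4 4^L v^2, hence 15 m < 4^L; moreover 4^L <= a^2
   <= n <= N. *)
- split.
    rewrite -(ler_nat R) natrM natrX -(ler_pM2r (exprn_gt0 2 v0)).
    rewrite -[leLHS]mulrA; lra.
  rewrite (leq_trans _ nN) // -(ler_nat R) natrX.
  have h1 : 4 ^+ L <= 4 ^+ L * v ^+ 2 by rewrite ler_peMr ?(ltW q0) // exprn_ege1.
  have h2 : c1 ^+ 2 * a ^+ 2 <= 1 * a ^+ 2 by rewrite ler_wpM2r // sqr_ge0.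
  have h3 : a ^+ 2 <= n%:R.
    by rewrite a2 ler_pdivrMr ?exprn_gt0 // ler_peMr ?(ltW nR) // exprn_ege1.
  lra.
- have p3 : 0 < 4 / c1 ^+ 2 * y by rewrite mulr_gt0.
  have p4 : 0 < 4 / c1 ^+ 2 * y * Lam ^+ 2 by rewrite mulr_gt0 // exprn_gt0.
  (* By maximality of [L], N / 4^L is at most exp(Lam) Lam^2, whose logarithm Lam + 2 ln Lam is at
     most 3 Lam. *)
  apply: (@le_trans _ _ (ln (4 / c1 ^+ 2 * y * Lam ^+ 2))).
    rewrite ler_ln ?posrE ?divr_gt0 // ler_pdivrMr //.
    have h1 : n%:R * c1 ^+ 2 <= 4 * 4 ^+ L * v ^+ 2 * psi ^+ 4.
      move/ltW: L2s; rewrite a2 mulrA ler_pdivrMr ?exprn_gt0 //; lra.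
    have h2 : v ^+ 2 * psi ^+ 4 <= Lam ^+ 2 * psi ^+ 6.
      apply: ler_pM; rewrite ?exprn_ge0 ?(ltW v0) ?(ltW psi0) //.
        by rewrite lerXn2r ?nnegrE ?(ltW v0) ?(ltW Lam0).
      by rewrite ler_weXn2l.
    have h3 : n%:R * c1 ^+ 2 <= 4 * 4 ^+ L * (Lam ^+ 2 * psi ^+ 6).
      by apply: le_trans h1 _; rewrite -mulrA ler_wpM2l // mulr_ge0 // ltW.
    have -> : 4 / c1 ^+ 2 * y * Lam ^+ 2 * 4 ^+ L =
        N%:R * ((4 * 4 ^+ L * (Lam ^+ 2 * psi ^+ 6)) / (n%:R * c1 ^+ 2)).
      by rewrite /y; field; rewrite !gt_eqF.
    by rewrite ler_peMr ?(ltW N0) // ler_pdivlMr ?mulr_gt0 // mul1r.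
  rewrite lnM ?posrE ?exprn_gt0 // -Cy -LamE lnXn // mulr2n.
  by have := ln_sublinear Lam0; lra.
- by rewrite mulrC.
(* Maximality again, together with v <= Lam, which holds since 1 <= r. *)
- apply: ltW; apply: lt_le_trans L2 _; rewrite exprS -mulrA ler_wpM2l //.
  by rewrite ler_wpM2l // exprn_ge0.
Qed.

End parameters.

(** * Column lengths, and the combination of the two exceptional events *)

Lemma measurable_bigmax {d : measure_display} {T : measurableType d} {R : realType}
    (I : Type) (s : seq I) (f : I -> T -> R) :
  (forall i, measurable_fun [set: T] (f i)) ->
  measurable_fun [set: T] (fun w => \big[Num.max/0]_(i <- s) f i w).
Proof.
move=> mf; elim: s => [|i s IH].
  by under eq_fun do rewrite big_nil; exact: measurable_cst.
by under eq_fun do rewrite big_cons; exact: measurable_maxr.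
Qed.

(** Hence the threshold of the theorem keeps |X_i|^2 within n/4 of n. *)
Lemma sqrt2_le (R : realType) : (Num.sqrt 2 - 1) / 2 <= 4^-1 :> R.
Proof.
have : Num.sqrt 2 <= 3 / 2 :> R.
  rewrite -(ler_pXn2r (n := 2)) ?nnegrE ?sqrtr_ge0 // ?divr_ge0 // sqr_sqrtr //.
  by rewrite expr2; lra.
lra.
Qed.

Theorem theorem4p3 (R : realType) :
  exists C c : R, 0 < C /\ 0 < c /\
  forall (m n N : nat) (r psi lam : R)
    (d : measure_display) (T : measurableType d) (P : probability T R)
    (X : 'I_N -> {RV P >-> n.-tuple R}),
    (1 <= m <= n)%N -> (n <= N)%N ->
    1 <= r <= 2 -> 1 <= psi -> 0 < lam < 2^-1 ->
    independent_RVs X ->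
    (forall i, centered (X i)) ->
    (forall i y, usphere y ->
       (psi_norm P r (fun w => dotp (vec (X i w)) y) <= psi%:E)%E) ->
    (P [set w | ((Num.sqrt 2 - 1) / 2 <=
           \big[Num.max/0]_(i < N) `|enorm (vec (X i w)) ^+ 2 / n%:R - 1|)%R]
       < lam%:E)%E ->
    m%:R <= c * n%:R /
      (psi ^+ 4 * ln (C * psi ^+ 6 * N%:R / n%:R) `^ (2 / r)) ->
    exists E : set T,
      [/\ measurable E,
          ((1 - 2 * lam - C * expR (- c * Num.sqrt n%:R / psi ^+ 2))%:E
             < P E)%E &
          forall w, E w ->
            neighborly m (Kplus (colmx X w)) /\
            centrally_neighborly m (Ksym (colmx X w))].
Proof.
(* 688 is 344 times the 2 of the scale [2 * psi]; 1/16 is the smallness that the bootstrap asks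
   for. *)
have [c1 [c0 c1le c1small]] : exists c1 : R, [/\ 0 < c1, c1 <= 1 & 688 * c1 <= 16^-1].
  by exists (688^-1 * 16^-1); split; lra.
have c2 : 0 < c1 ^+ 2 by rewrite exprn_gt0.
have C0 : 0 < 4 / c1 ^+ 2 by rewrite divr_gt0.
(* 60 is the 15 in 15 m <= 4^L times the 4 lost in 4^L by rounding down to a power of 2; 4 / c1^2
   makes up for that loss inside the logarithm. *)
exists (4 / c1 ^+ 2), (c1 ^+ 2 / 60); split => //; split; first by rewrite divr_gt0.
move=> m n N r psi lam d T P X /andP[m0 mn] nN /andP[r1 _] psi1 /andP[lam0 _] ind _.
move=> Xpsi Pmax mle.
have n0 : (0 < n)%N by exact: leq_trans m0 mn.
have nR : 0 < n%:R :> R by rewrite ltr0n.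
have psi0 : 0 < psi by rewrite (lt_le_trans ltr01).
have r0 : 0 < r by rewrite (lt_le_trans ltr01).
set Lam := ln _ in mle.
have c1P : 0 < c1 <= 1 by rewrite c0.
have [L [Lam1 [mL LN] lnLam small big]] :=
  choose_depth c1P m0 n0 nN r1 psi1 (erefl Lam) mle.
have Lam0 : 0 < Lam by rewrite (lt_le_trans ltr01).
have [B [mB PB goodB]] := tamed_event r0 psi0 ind Xpsi LN Lam1 lnLam.
set G := [set w | _] in Pmax.
have mG : measurable G.
  pose F w := \big[Num.max/0]_(i < N) `|enorm (vec (X i w)) ^+ 2 / n%:R - 1|.
  have mF : measurable_fun [set: T] F.
    apply: (measurable_bigmax (index_enum 'I_N)
      (f := fun i w => `|enorm (vec (X i w)) ^+ 2 / n%:R - 1|)) => i.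
    apply: measurableT_comp => //; apply: measurable_funB => //.
    apply: measurable_funM => //; apply: measurable_funX.
    exact/measurable_enorm/measurable_vec.
  rewrite (_ : G = F @^-1` [set` `[(Num.sqrt 2 - 1) / 2, +oo[]).
    by rewrite -[X in measurable X]setTI; apply: mF.
  by apply/seteqP; split => w /=; rewrite in_itv /= andbT.
have mGB : measurable (G `|` B) by exact: measurableU.
exists (~` (G `|` B)); split; first exact: measurableC.
(* Bad column lengths cost less than [lam], untamed levels the exponential term. *)
- have PGB : (P (G `|` B) < (lam + 2 * expR (- (2 ^+ L * Lam)))%:E)%E.
    rewrite EFinD; apply: le_lt_trans (measureU2 _ mG mB) _.
    by apply: lte_leD => //; rewrite fin_num_measure.
  rewrite probability_setC //.
  have PE : P (G `|` B) = (fine (P (G `|` B)))%:E by rewrite fineK ?fin_num_measure.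
  rewrite PE lte_fin in PGB; rewrite PE -EFinB lte_fin.
  (* By [big], 2^L Lam is at least c1 / 2 times sqrt(n) / psi^2, which exceeds c1^2 / 60 times it as
     c1 <= 1. *)
  have e1 : expR (- (2 ^+ L * Lam)) <=
      expR (- (c1 ^+ 2 / 60) * Num.sqrt n%:R / psi ^+ 2).
    rewrite ler_expR -mulrA mulNr lerN2.
    have a0 : 0 <= Num.sqrt n%:R / psi ^+ 2 by rewrite divr_ge0 ?sqrtr_ge0 ?sqr_ge0.
    have : c1 ^+ 2 * (Num.sqrt n%:R / psi ^+ 2) <= c1 * (Num.sqrt n%:R / psi ^+ 2).
      by rewrite ler_wpM2r // expr2 ler_piMr // ltW.
    have : 0 <= 2 ^+ L * Lam by rewrite mulr_ge0 ?exprn_ge0 // ltW.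
    lra.
  have e2 : 2 * expR (- (2 ^+ L * Lam)) <=
      4 / c1 ^+ 2 * expR (- (c1 ^+ 2 / 60) * Num.sqrt n%:R / psi ^+ 2).
    apply: ler_pM; rewrite ?expR_ge0 //.
    by rewrite ler_pdivlMr //; have := exprn_ile1 2 (ltW c0) c1le; lra.
  lra.
- move=> w /not_orP [Gw Bw].
  have colE j : col j (colmx X w) = vec (X j w) by apply/colP => k; rewrite !mxE.
  have diag j : 3 / 4 * n%:R <= dotp (col j (colmx X w)) (col j (colmx X w)) <= 5 / 4 * n%:R.
    have : `|enorm (vec (X j w)) ^+ 2 / n%:R - 1| <= 4^-1.
      have /negP := Gw; rewrite -ltNge => Gw'.
      have := le_bigmax 0 (fun i => `|enorm (vec (X i w)) ^+ 2 / n%:R - 1|) j.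
      by have := sqrt2_le R; lra.
    rewrite sqr_enorm -colE; set u := dotp _ _.
    have -> : u / n%:R - 1 = (u - n%:R) / n%:R by field; rewrite gt_eqF.
    rewrite ler_norml ler_pdivrMr // ler_pdivlMr // => /andP[h1 h2].
    by apply/andP; split; lra.
  have colsE : (fun j => col j (colmx X w)) = fun j => vec (X j w) by apply/funext.
  have nsp : null_space_property m (colmx X w).
    apply: (@null_space_of_tamed _ n N L m _ (2 * psi) r Lam) => //.
    - by rewrite mulr_gt0.
    - by move=> f l f5; rewrite colsE; exact: goodB.
    - have h1 : psi * (Lam `^ r^-1 * 2 ^+ L) <=
          psi * (c1 * (Num.sqrt n%:R / psi ^+ 2)) by rewrite ler_wpM2l // ltW.
      (* One factor of psi^2 cancels the psi of the scale, and the other is at least 1. *)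
      have h2 : psi * (c1 * (Num.sqrt n%:R / psi ^+ 2)) <= c1 * Num.sqrt n%:R.
        rewrite (_ : _ * _ = c1 * Num.sqrt n%:R / psi); last first.
          by field; rewrite gt_eqF.
        by rewrite ler_pdivrMr // ler_peMr // mulr_ge0 ?sqrtr_ge0 // ltW.
      have h3 : 688 * c1 * Num.sqrt n%:R <= 16^-1 * Num.sqrt n%:R.
        by rewrite ler_wpM2r ?sqrtr_ge0.
      lra.
  by split; [exact: Kplus_neighborly|exact: Ksym_neighborly].
Qed.
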